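(* Let $c^* := \max_{a>0} \frac{1}{2a^2}\left(1-4e^{-\frac{a^2}{4}+2}\right)$ (numerically $c^*=0.02011\dots$, attained at $a = 4.566\dots$), and let $p_0 = 0.01139\dots$ denote the root in $(0,1)$ of $\frac{p\sqrt{3-2p}}{(1-p)^2} = c^*$. There exists a sequence of instructions such that, for any $p < p_0$ and any $x_{\mathrm{home}}\in\mathbb{Z}^2$, the guided random walk following these instructions satisfies $\mathbb{E}[T]<\infty$, where $T$ is the time step when the agent finds home.
   Context: Fix $p\in[0,1]$. A sequence of instructions is an infinite walk $(x_t)_{t\ge 0}$ in $\mathbb{Z}^2$ with $x_0=0$ and $x_{t+1}-x_t\in\{(\pm1,0),(0,\pm1)\}$; it may depend on the location $x_{\mathrm{home}}\in\mathbb{Z}^2$ of home (and the construction may use auxiliary randomness independent of the agent's errors). The guided random walk following these instructions is the Markov chain $(X_t)_{t\ge0}$ with $X_0=0$ and, independently at each step, $X_{t+1}-X_t = x_{t+1}-x_t$ with probability $1-p$, and $X_{t+1}-X_t$ uniformly distributed on $\{(\pm1,0),(0,\pm1)\}$ with probability $p$. The time the agent finds home is $T:=\inf\{t\ge 0 : X_t = x_{\mathrm{home}}\}$. *)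

(* Defs.v *)
From HB Require Import structures.
From mathcomp Require Import all_boot all_order all_algebra.
From mathcomp Require Import all_classical all_reals all_analysis.
Set Implicit Arguments. Unset Strict Implicit. Unset Printing Implicit Defensive.
Import Order.TTheory GRing.Theory Num.Theory.
Local Open Scope ring_scope.

Definition pt := (int * int)%type.
Definition ptadd (a b : pt) : pt := (a.1 + b.1, a.2 + b.2).
Definition origin : pt := (0, 0).

Definition dir (d : 'I_4) : pt :=
  match val d with
  | 0 => (1, 0)
  | 1 => (-1, 0)
  | 2 => (0, 1)
  | _ => (0, -1)
  end.

Definition is_instr (x : nat -> pt) : Prop :=
  x 0%N = origin /\ forall t, exists d : 'I_4, x t.+1 = ptadd (x t) (dir d).

(* Transition law of one step of the guided walk at time t -> t+1:
   the instructed step with prob. 1-p, plus a uniform step with prob. p. *)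
Definition step_prob {R : realType} (p : R) (x : nat -> pt) (t : nat) (d : 'I_4) : R :=
  (1 - p) * (x t.+1 == ptadd (x t) (dir d))%:R + p / 4.

Definition pos {t : nat} (ds : t.-tuple 'I_4) (k : nat) : pt :=
  foldr ptadd origin [seq dir d | d <- take k ds].

Definition tail_prob {R : realType} (p : R) (x : nat -> pt) (h : pt) (t : nat) : R :=
  \sum_(ds : t.-tuple 'I_4)
     (\prod_(i < t) step_prob p x i (tnth ds i)) *
     [forall k : 'I_t.+1, pos ds k != h]%:R.

(* E[T] (in [0, +oo]) for T = inf{t : X_t = h}, via E[T] = sum_{t>=0} P(T > t)
   (valid for T with values in N u {oo}). *)
Definition expected_hit {R : realType} (p : R) (x : nat -> pt) (h : pt) : \bar R :=
  (\sum_(0 <= t <oo) (tail_prob p x h t)%:E)%E.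

Definition cstar {R : realType} : R :=
  sup [set (1 - 4 * expR (- (a ^+ 2) / 4 + 2)) / (2 * a ^+ 2) | a in [set a : R | 0 < a]].

Definition p0_fun {R : realType} (p : R) : R :=
  p * Num.sqrt (3 - 2 * p) / (1 - p) ^+ 2.

(* Main.v *)
(** The instructions proceed in rounds.  Round [n] is a closed loop of length
    O(n) through the origin: a random vertical offset, then a sweep of 16 long
    horizontal rows spaced evenly over a rectangle of sides O(n), then the way
    back.  Home is never used.

    Errors are independent of the instructions, so for a fixed error pattern
    the position of the agent during the sweep depends on the random offset only
    through a vertical translation, which moves by 0 or 2 when the offset moves
    by 1.  Hence, whenever home lies in the rectangle seen from the agent's
    displacement at the start of the round, each offset range contains a value
    hitting it, and the round succeeds with probability at least about
    [(1 - p) / (2 K)], [K] being the half-width of the offset range.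

    At the start of round [n] the displacement [z] performs a centered walk, and
    [V n z = (n^4 + c1 (z1 - h1)^4 + c2 (z2 - h2)^4) / (n (n + 1))] is a Lyapunov
    function: inside the rectangle the killing beats its growth, outside the
    quartic terms decay by themselves, so that [V] decreases by a multiple of
    [n] on average.  Summing, [n P(T > start of round n)] is summable, which is
    [E T < oo] because round [n] lasts O(n) steps.  This works for
    [p <= 3/250], and [p0 <= 3/250] follows from an upper bound on [cstar]. *)

Require Import Defs.
From HB Require Import structures.
From mathcomp Require Import all_boot all_order all_algebra.
From mathcomp Require Import all_classical all_reals all_analysis.
From mathcomp Require Import measurable_realfun zify ring lra.
Import Order.TTheory GRing.Theory Num.Theory.
Local Open Scope ring_scope.
Local Open Scope classical_set_scope.

(** * Guided walks and their noise *)

(** [None] means that the instruction is obeyed, [Some d] that the error [d] replaces it. The law of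
    the noise does not depend on the instruction, so different instruction sequences can be run
    against the same errors. *)
Definition noise := option 'I_4.

Definition move (d : 'I_4) (e : noise) : pt := dir (odflt d e).

Definition mean {R : realType} (p : R) (f : noise -> R) : R :=
  (1 - p) * f None + p / 4 * \sum_(d < 4) f (Some d).

Fixpoint expect {R : realType} (p : R) (n : nat) (g : seq noise -> R) : R :=
  if n is n'.+1 then mean p (fun e => expect p n' (fun es => g (e :: es)))
  else g [::].

(** Expectation of [f] at the final position over the walks from [z] that avoid [h], both endpoints
    included. With [f = 1] it is a survival probability. *)
Fixpoint surv {R : realType} (p : R) (h : pt) (l : seq 'I_4) (f : pt -> R)
    (z : pt) : R :=
  if z == h then 0
  else if l is d :: l' then mean p (fun e => surv p h l' f (z + move d e))
  else f z.

Fixpoint disp (l : seq 'I_4) (es : seq noise) : pt :=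
  match l, es with
  | d :: l', e :: es' => move d e + disp l' es'
  | _, _ => 0
  end.

Fixpoint hits (h z : pt) (l : seq 'I_4) (es : seq noise) : bool :=
  (z == h) ||
  match l, es with
  | d :: l', e :: es' => hits h (z + move d e) l' es'
  | _, _ => false
  end.

Definition drift (l : seq 'I_4) : pt := \sum_(d <- l) dir d.

Lemma eq_mean (R : realType) (p : R) (f g : noise -> R) :
  f =1 g -> mean p f = mean p g.
Proof. by move=> fg; rewrite /mean fg; under eq_bigr do rewrite fg. Qed.

Lemma mean_cst (R : realType) (p c : R) : mean p (fun=> c) = c.
Proof. by rewrite /mean sumr_const card_ord -mulr_natl; field. Qed.

Lemma mean_linear (R : realType) (p a b : R) (f g : noise -> R) :
  mean p (fun e => a * f e + b * g e) = a * mean p f + b * mean p g.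
Proof. by rewrite /mean big_split /= -!mulr_sumr; ring. Qed.

Lemma le_mean (R : realType) (p : R) (f g : noise -> R) :
  0 <= p <= 1 -> (forall e, f e <= g e) -> mean p f <= mean p g.
Proof.
move=> /andP[p0 p1] fg; rewrite /mean lerD// ler_wpM2l ?subr_ge0 ?divr_ge0//.
by apply: ler_sum => i _; exact: fg.
Qed.

Lemma eq_expect (R : realType) (p : R) n (f g : seq noise -> R) :
  (forall es, size es = n -> f es = g es) -> expect p n f = expect p n g.
Proof.
elim: n f g => [|n IH] f g fg /=; first exact: fg.
by apply: eq_mean => e; apply: IH => es ses; apply: fg; rewrite /= ses.
Qed.

Lemma expect_cst (R : realType) (p c : R) n : expect p n (fun=> c) = c.
Proof. by elim: n => //= n IH; rewrite (eq_mean _ _ _ _ (fun=> IH)) mean_cst. Qed.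

Lemma expect_linear (R : realType) (p a b : R) n (f g : seq noise -> R) :
  expect p n (fun es => a * f es + b * g es) = a * expect p n f + b * expect p n g.
Proof.
elim: n f g => [//|n IH] f g /=.
by rewrite -mean_linear; apply: eq_mean => e; rewrite -IH.
Qed.

Lemma expectD (R : realType) (p : R) n (f g : seq noise -> R) :
  expect p n (fun es => f es + g es) = expect p n f + expect p n g.
Proof.
rewrite -[RHS]/(_ + _) -[expect p n f]mul1r -[expect p n g]mul1r -expect_linear.
by apply: eq_expect => es _; rewrite !mul1r.
Qed.

Lemma expectZ (R : realType) (p a : R) n (f : seq noise -> R) :
  expect p n (fun es => a * f es) = a * expect p n f.
Proof.
rewrite -[RHS]addr0 -[X in _ + X](mul0r (expect p n f)) -expect_linear.
by apply: eq_expect => es _; rewrite mul0r addr0.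
Qed.

Lemma expect_sum (R : realType) (p : R) n (I : Type) (r : seq I)
    (F : I -> seq noise -> R) :
  expect p n (fun es => \sum_(i <- r) F i es) = \sum_(i <- r) expect p n (F i).
Proof.
elim: r => [|i r IH].
  by rewrite big_nil -[RHS](expect_cst _ p 0 n); apply: eq_expect => es _; rewrite big_nil.
rewrite big_cons -IH -expectD; apply: eq_expect => es _; exact: big_cons.
Qed.

Lemma le_expect (R : realType) (p : R) n (f g : seq noise -> R) :
  0 <= p <= 1 -> (forall es, size es = n -> f es <= g es) ->
  expect p n f <= expect p n g.
Proof.
move=> p01; elim: n f g => [|n IH] f g fg /=; first exact: fg.
by apply: le_mean => // e; apply: IH => es ses; apply: fg; rewrite /= ses.
Qed.

Lemma surv_start (R : realType) (p : R) h l f : surv p h l f h = 0.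
Proof. by case: l => [|d l] /=; rewrite eqxx. Qed.

(** Averaging over whole noise sequences, rather than step by step, allows pathwise comparison of
    different instruction sequences. *)
Lemma surv_expect (R : realType) (p : R) h l f z :
  surv p h l f z =
  expect p (size l) (fun es => (~~ hits h z l es)%:R * f (z + disp l es)).
Proof.
elim: l z => [|d l IH] z /=.
  by case: eqP => _; rewrite ?mul0r //= mul1r addr0.
case: eqP => _ /=; last first.
  by apply: eq_mean => e; rewrite IH; apply: eq_expect => es _; rewrite addrA.
rewrite -[LHS](mean_cst _ p 0); apply: eq_mean => e.
rewrite -[LHS](expect_cst _ p 0 (size l)).
by apply: eq_expect => es _; rewrite mul0r.
Qed.

Lemma surv_cat (R : realType) (p : R) h l1 l2 f z :
  surv p h (l1 ++ l2) f z = surv p h l1 (surv p h l2 f) z.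
Proof.
elim: l1 z => [|d l IH] z /=.
  by case: eqP => [->|//]; exact: surv_start.
by case: eqP => // _; apply: eq_mean.
Qed.

Lemma le_surv (R : realType) (p : R) h l (f g : pt -> R) z :
  0 <= p <= 1 -> (forall y, f y <= g y) -> surv p h l f z <= surv p h l g z.
Proof.
move=> p01 fg; elim: l z => [|d l IH] z /=; case: eqP => // _.
exact: le_mean.
Qed.

Lemma surv_linear (R : realType) (p a b : R) h l (f g : pt -> R) z :
  surv p h l (fun y => a * f y + b * g y) z = a * surv p h l f z + b * surv p h l g z.
Proof.
elim: l z => [|d l IH] z /=; case: eqP => // _; rewrite ?mulr0 ?addr0 //.
by rewrite -mean_linear; apply: eq_mean.
Qed.

Lemma surv_ge0 (R : realType) (p : R) h l (f : pt -> R) z :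
  0 <= p <= 1 -> (forall y, 0 <= f y) -> 0 <= surv p h l f z.
Proof.
move=> p01 f0; elim: l z => [|d l IH] z /=; case: eqP => // _.
by rewrite -[leLHS](mean_cst _ p 0) le_mean.
Qed.

Lemma surv_le1 (R : realType) (p : R) h l z :
  0 <= p <= 1 -> surv p h l (fun=> 1) z <= 1.
Proof.
move=> p01; elim: l z => [|d l IH] z /=; case: eqP => // _.
by rewrite -[leRHS](mean_cst _ p 1) le_mean.
Qed.

Lemma surv_sum (R : realType) (p : R) h l (I : Type) (r : seq I)
    (F : I -> pt -> R) z :
  surv p h l (fun y => \sum_(i <- r) F i y) z = \sum_(i <- r) surv p h l (F i) z.
Proof.
rewrite surv_expect; under [RHS]eq_bigr do rewrite surv_expect.
by rewrite -expect_sum; apply: eq_expect => es _; rewrite mulr_sumr.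
Qed.

Lemma eq_surv (R : realType) (p : R) h l (f g : pt -> R) z :
  f =1 g -> surv p h l f z = surv p h l g z.
Proof.
by move=> fg; rewrite !surv_expect; apply: eq_expect => es _; rewrite fg.
Qed.

Lemma expect_hits (R : realType) (p : R) h l z :
  expect p (size l) (fun es => (hits h z l es)%:R) = 1 - surv p h l (fun=> 1) z.
Proof.
apply/eqP; rewrite eq_sym subr_eq surv_expect -expectD; apply/eqP.
rewrite -[LHS](expect_cst _ p 1 (size l)); apply: eq_expect => es _.
by case: (hits _ _ _ _); rewrite /= ?mulr1 ?addr0 ?add0r.
Qed.

(* A survivor never pays less than [M], so killing removes at least [M] times the hitting probability. *)
Lemma surv_le_expect (R : realType) (p M : R) h l (f : pt -> R) z :
  0 <= p <= 1 -> (forall y, M <= f y) ->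
  surv p h l f z <=
  expect p (size l) (fun es => f (z + disp l es)) - M * (1 - surv p h l (fun=> 1) z).
Proof.
move=> p01 Mf; rewrite -expect_hits -mulNr -expectZ -expectD surv_expect.
apply: le_expect => // es _.
by case: (hits _ _ _ _) => /=; rewrite ?mul0r ?mulr1 ?subr_ge0 // mul1r mulr0 addr0.
Qed.

(** * Tail probabilities in terms of [surv] *)

Lemma dir_inj : injective dir.
Proof.
move=> i j ij; have : (dir i == dir j) ==> (i == j) by
  move: i j {ij} => [[|[|[|[|i]]]] ?] [[|[|[|[|j]]]] ?].
by rewrite ij eqxx => /eqP.
Qed.

Lemma mean_dir (R : realType) (p : R) (c : 'I_4) (f : 'I_4 -> R) :
  mean p (fun e => f (odflt c e)) = \sum_(d < 4) ((1 - p) * (d == c)%:R + p / 4) * f d.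
Proof.
rewrite /mean /=; under [RHS]eq_bigr do rewrite mulrDl.
rewrite big_split /= -mulr_sumr; congr (_ + _).
rewrite (bigD1 c) //= eqxx mulr1 big1 ?addr0 //.
by move=> d /negPf ->; rewrite mulr0 mul0r.
Qed.

Lemma big_tuple_cons (R : nmodType) (T : finType) n (F : n.+1.-tuple T -> R) :
  \sum_(s : n.+1.-tuple T) F s = \sum_(d : T) \sum_(s : n.-tuple T) F [tuple of d :: s].
Proof.
rewrite pair_big /= (reindex (fun q : T * n.-tuple T => [tuple of q.1 :: q.2])) //=.
exists (fun s => (thead s, [tuple of behead s])) => [[d s] _|s _] /=.
  by congr pair; exact: val_inj.
by rewrite [RHS]tuple_eta.
Qed.

Lemma pos_cons n (d : 'I_4) (s : n.-tuple 'I_4) k :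
  pos [tuple of d :: s] k.+1 = dir d + pos s k.
Proof. by []. Qed.

(** The start [z] is arbitrary for the induction: the first direction is split off the tuple, and
    [mean_dir] reads its law as an obeyed instruction or a uniform error. *)
Lemma sum_paths (R : realType) (p : R) (h : pt) (l : seq 'I_4) (c : nat -> 'I_4) (z : pt) n :
  l = mkseq c n ->
  \sum_(ds : n.-tuple 'I_4)
     (\prod_(i < n) ((1 - p) * (tnth ds i == c i)%:R + p / 4)) *
     [forall k : 'I_n.+1, z + pos ds k != h]%:R = surv p h l (fun=> 1) z.
Proof.
elim: n l c z => [|n IH] l c z ->.
  rewrite (big_pred1 [tuple]) => [|s]; last by rewrite [s]tuple0 /= eqxx.
  rewrite big_ord0 mul1r /=; case: ifP => zh.
    case: forallP => // /(_ ord0); rewrite /pos take0 /= => /eqP[].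
    by rewrite (eqP zh) addr0.
  case: forallP => // -[] k; rewrite (ord1 k) /pos /=.
  by rewrite addr0 zh.
rewrite big_tuple_cons /mkseq [iota 0 n.+1]/= map_cons.
rewrite (iotaDl 1 0 n) -map_comp.
rewrite [surv _ _ _ _ _]/=.
case: ifP => zh.
  rewrite big1 // => d _; rewrite big1 // => s _.
  case: forallP => [/(_ ord0)|_]; last by rewrite mulr0.
  by rewrite /pos take0 /= addr0 (eqP zh) eqxx.
rewrite (mean_dir _ _ _ (fun d => surv p h _ (fun=> 1) (z + dir d))).
apply: eq_bigr => d _; rewrite -(IH _ (c \o S)) ?mulr_sumr; last first.
  exact: eq_map.
apply: eq_bigr => s _; rewrite big_ord_recl /= mulrA; congr (_ * _ * _).
  by apply: eq_bigr => i _; rewrite tnthS.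
congr (nat_of_bool _)%:R; apply/forallP/forallP => H k.
  by have := H (lift ord0 k); rewrite pos_cons addrA.
case: (unliftP ord0 k) => [j|] ->; first by rewrite pos_cons addrA; exact: H.
by rewrite /pos take0 /= addr0 zh.
Qed.

Lemma tail_prob_surv (R : realType) (p : R) (x : nat -> pt) (c : nat -> 'I_4) (h : pt) n :
  (forall t, x t.+1 = x t + dir (c t)) ->
  tail_prob p x h n = surv p h (mkseq c n) (fun=> 1) 0.
Proof.
move=> xc; rewrite -(sum_paths _ _ _ _ c _ _ erefl); apply: eq_bigr => ds _.
congr (_ * _%:R); last by under [in RHS]eq_forallb => k do rewrite add0r.
apply: eq_bigr => i _; rewrite /step_prob xc -[ptadd]/(+%R) (inj_eq (addrI _)).
by rewrite (inj_eq dir_inj) eq_sym.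
Qed.

(** * Fluctuations around the drift *)

Definition axis (c : bool) (z : pt) : int := if c then z.2 else z.1.

Lemma axisD c : {morph axis c : y z / y + z}.
Proof. by case: c. Qed.

(** Uniform errors have mean zero, so the mean displacement is [1 - p] times the drift; what remains
    is a sum of independent centered steps. *)
Definition centered {R : realType} (p : R) c l es : R :=
  (axis c (disp l es))%:~R - (1 - p) * (axis c (drift l))%:~R.

(** An upper bound on the variance, which is exactly [p / 2] across the instructed direction and
    [3 p / 2 - p^2] along it; the [p^2] is dropped. *)
Definition step_var {R : realType} (p : R) (c : bool) (d : 'I_4) : R :=
  if axis c (dir d) == 0 then p / 2 else p * (3 / 2).

Definition centered_step {R : realType} (p : R) c d e : R :=
  (axis c (move d e))%:~R - (1 - p) * (axis c (dir d))%:~R.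

Lemma drift_cons d l : drift (d :: l) = dir d + drift l.
Proof. exact: big_cons. Qed.

Lemma drift_cat l1 l2 : drift (l1 ++ l2) = drift l1 + drift l2.
Proof. exact: big_cat. Qed.

Lemma centered_cons (R : realType) (p : R) c d l e es :
  centered p c (d :: l) (e :: es) = centered_step p c d e + centered p c l es.
Proof.
by rewrite /centered /centered_step drift_cons /= !axisD !intrD; ring.
Qed.

Lemma dir_ind (P : 'I_4 -> Prop) :
  P (inord 0) -> P (inord 1) -> P (inord 2) -> P (inord 3) -> forall d, P d.
Proof.
move=> P0 P1 P2 P3 d; rewrite -(inord_val d).
by case: d => [[|[|[|[|]]]]] /=.
Qed.

Lemma dirE : (dir (inord 0) = (1, 0)) * (dir (inord 1) = (-1, 0)) *
  (dir (inord 2) = (0, 1)) * (dir (inord 3) = (0, -1)).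
Proof. by rewrite /dir /= !inordK. Qed.

Lemma sum_dir (R : nmodType) (f : 'I_4 -> R) :
  \sum_(d < 4) f d = f (inord 0) + f (inord 1) + f (inord 2) + f (inord 3).
Proof.
rewrite !big_ord_recr big_ord0 /= add0r.
by congr (f _ + f _ + f _ + f _); apply: val_inj; rewrite /= inordK.
Qed.

Lemma mean_centered_step (R : realType) (p : R) c d :
  mean p (centered_step p c d) = 0.
Proof.
elim/dir_ind: d; case: c;
  by rewrite /mean sum_dir /centered_step /move /= !dirE /=; field.
Qed.

Lemma mean_centered_step2 (R : realType) (p : R) c d :
  0 <= p <= 1 -> mean p (fun e => centered_step p c d e ^+ 2) <= step_var p c d.
Proof.
move=> p01; elim/dir_ind: d; case: c;
  rewrite /mean sum_dir /centered_step /step_var /move /= !dirE /= ?eqxx; nra.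
Qed.

Lemma centered_step_le2 (R : realType) (p : R) c d e :
  0 <= p <= 1 -> centered_step p c d e ^+ 2 <= 4.
Proof.
move=> /andP[p0 p1]; have pp : 0 <= p * (1 - p) by rewrite mulr_ge0 ?subr_ge0.
elim/dir_ind: d; (case: e => [d|]; [elim/dir_ind: d | idtac]);
  case: c; rewrite /centered_step /move /= !dirE /=; nra.
Qed.

Definition path_var {R : realType} (p : R) c (l : seq 'I_4) : R :=
  \sum_(d <- l) step_var p c d.

Lemma step_var_bound (R : realType) (p : R) c d :
  0 <= p <= 1 -> 0 <= step_var p c d <= 3 / 2.
Proof.
by rewrite /step_var => /andP[p0 p1]; case: ifP => _; apply/andP; split; lra.
Qed.

Lemma path_var_bound (R : realType) (p : R) c l :
  0 <= p <= 1 -> 0 <= path_var p c l <= 3 / 2 * (size l)%:R.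
Proof.
move=> p01; rewrite /path_var; elim: l => [|d l IH].
  by rewrite big_nil mulr0 lexx.
rewrite big_cons /= -natr1; have /andP[v0 v1] := step_var_bound _ p c d p01.
move/andP: IH => [S0 S1]; apply/andP; split; lra.
Qed.

(* AM-GM trades the third moment for a little extra variance: [4 a x^3 <= a^2 x^2 / 10 + 40 x^4]. *)
Lemma quartic_step (R : realType) (p a b : R) c d :
  0 <= p <= 1 -> 0 <= b ->
  mean p (fun e => (a + centered_step p c d e) ^+ 4 + b * (a + centered_step p c d e) ^+ 2)
  <= a ^+ 4 + 61 / 10 * step_var p c d * a ^+ 2 + 164 * step_var p c d
     + b * (a ^+ 2 + step_var p c d).
Proof.
move=> p01 b0; set x := centered_step p c d.
have x4 e : x e ^+ 4 <= 4 * x e ^+ 2.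
  by rewrite -[4%N]/(2 + 2)%N exprD; apply: ler_wpM2r; rewrite ?sqr_ge0 ?centered_step_le2.
pose k1 := 4 * a ^+ 3 + 2 * a * b.
pose k2 := 61 / 10 * a ^+ 2 + 164 + b.
pose k0 := a ^+ 4 + b * a ^+ 2.
apply: (@le_trans _ _ (mean p (fun e => 1 * (k1 * x e + k2 * x e ^+ 2) + k0 * 1))).
  apply: le_mean => // e; have := x4 e; move: (x e) => t t4.
  have := sqr_ge0 (a * t / 10 - 2 * t ^+ 2).
  rewrite /k0 /k1 /k2 => sq.
  (* The slack is explicit: 10 times the AM-GM square, and 41 times [4 t^2 - t^4], whence
     [164 = 4 * 41]. *)
  have -> : (a + t) ^+ 4 + b * (a + t) ^+ 2 = 1 * ((4 * a ^+ 3 + 2 * a * b) * t +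
     (61 / 10 * a ^+ 2 + 164 + b) * t ^+ 2) + (a ^+ 4 + b * a ^+ 2) * 1
      - (10 * (a * t / 10 - 2 * t ^+ 2) ^+ 2 + 41 * (4 * t ^+ 2 - t ^+ 4)) by field.
  lra.
rewrite mean_linear mean_linear mean_centered_step mean_cst.
have := mean_centered_step2 _ p c d p01; rewrite -/x.
set m := mean _ _ => mv.
have k2_ge0 : 0 <= k2 by rewrite /k2; have := sqr_ge0 a; lra.
have := ler_wpM2l k2_ge0 mv; rewrite /k0 /k2; lra.
Qed.

(** Peel off the first step: [quartic_step] with [b = 61/10 S], where [S] is the variance bound of
    the rest, reproduces the middle term. A step then costs at most [164 * 3/2 = 246] plus a term
    linear in the length, which the increment of 250 times the squared length absorbs. *)
Lemma moment4 (R : realType) (p a : R) c l n :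
  0 <= p <= 1 -> (size l <= n)%N ->
  expect p n (fun es => (a + centered p c l es) ^+ 4) <=
  a ^+ 4 + 61 / 10 * path_var p c l * a ^+ 2 + 250 * (size l)%:R ^+ 2.
Proof.
move=> p01; elim: l n a => [|d l IH] [|n] a //= ln.
- by rewrite /centered /path_var big_nil /drift big_nil /axis; case: c => /=; nra.
- have e0 es : centered p c [::] es = 0.
    by rewrite /centered /drift big_nil /axis; case: c => /=; rewrite mulr0 subr0.
  rewrite (eq_mean _ _ _ (fun=> a ^+ 4)) => [|e].
    by rewrite mean_cst /path_var big_nil; lra.
  by rewrite -[RHS](expect_cst _ p _ n); apply: eq_expect => es _; rewrite e0 addr0.
set S := path_var p c l; set N : R := (size l)%:R.
have [S0 SN] : 0 <= S /\ S <= 3 / 2 * N by apply/andP; exact: path_var_bound.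
have N0 : 0 <= N by exact: ler0n.
apply: (@le_trans _ _ (mean p (fun e => 1 * ((a + centered_step p c d e) ^+ 4 +
    61 / 10 * S * (a + centered_step p c d e) ^+ 2) + (250 * N ^+ 2) * 1))).
  apply: le_mean => // e; rewrite mul1r mulr1; apply: le_trans (IH n _ ln).
  by under eq_expect do rewrite centered_cons addrA.
rewrite mean_linear mean_cst mul1r mulr1.
have b0 : 0 <= 61 / 10 * S by lra.
have := quartic_step _ p a _ c d p01 b0.
have /andP[v0 v1] := step_var_bound _ p c d p01.
rewrite /path_var big_cons -/(path_var p c l) -/S -natr1 -/N.
have : S * step_var p c d <= 9 / 4 * N by nra.
nra.
Qed.

(** * Search paths *)

Definition east : 'I_4 := inord 0.
Definition west : 'I_4 := inord 1.
Definition north : 'I_4 := inord 2.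
Definition south : 'I_4 := inord 3.

(** The length is [K] for every [j <= K], so the path that follows meets the same noise whatever the
    offset. *)
Definition offset (K j : nat) : seq 'I_4 := nseq j north ++ nseq (K - j) south.

Definition row_pair (B Q : nat) : seq 'I_4 :=
  nseq (2 * B) east ++ nseq (2 * Q) north ++ nseq (2 * B) west ++ nseq (2 * Q) north.

(** From the south-west corner, 16 rows of length [2 B] are run alternately east and west at heights
    [(2 i - 15) Q]; the last climb ends at height [17 Q]. *)
Definition snake (B Q : nat) : seq 'I_4 :=
  nseq B west ++ nseq (15 * Q) south ++ flatten (nseq 8 (row_pair B Q)).

Lemma drift_nseq n d : drift (nseq n d) = dir d *+ n.
Proof. by rewrite /drift big_nseq iter_addr_0. Qed.

Lemma drift_flatten_nseq n l : drift (flatten (nseq n l)) = drift l *+ n.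
Proof.
elim: n => [|n IH] /=; first by rewrite /drift big_nil.
by rewrite drift_cat IH mulrS.
Qed.

Lemma axisMn c (z : pt) n : axis c (z *+ n) = axis c z *+ n.
Proof. by elim: n => [|n IH]; [case: c | rewrite !mulrS axisD IH]. Qed.

Lemma drift_row_pair B Q : drift (row_pair B Q) = (0, (4 * Q)%:Z).
Proof.
rewrite /row_pair !drift_cat !drift_nseq !dirE.
by apply/eqP; rewrite -pair_eqE /pair_eq -!/(axis false _) -!/(axis true _)
  !axisD !axisMn /axis /=; lia.
Qed.

Lemma snake_row B Q i : (i < 16)%N ->
  exists (pre post : seq 'I_4) (s : bool),
  [/\ snake B Q = pre ++ nseq (2 * B) (if s then west else east) ++ post,
      axis false (drift pre) = (if s then B%:Z else - B%:Z) &
      axis true (drift pre) = (2 * i)%:Z * Q%:Z - 15 * Q%:Z].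
Proof.
move=> i16; pose a := i./2; have a8 : (a < 8)%N by rewrite /a; lia.
have ia : i = (odd i + 2 * a)%N by rewrite mul2n odd_double_half.
have -> : snake B Q = (nseq B west ++ nseq (15 * Q) south ++
    flatten (nseq a (row_pair B Q))) ++ row_pair B Q ++
    flatten (nseq (7 - a) (row_pair B Q)).
  rewrite /snake -!catA; congr (_ ++ (_ ++ _)).
  have -> : (8 = a + (1 + (7 - a)))%N by lia.
  by rewrite (nseqD a (1 + (7 - a))) (nseqD 1 (7 - a)) flatten_cat /= /row_pair -!catA.
have [oi|oi] := boolP (odd i); [rewrite oi in ia|rewrite (negPf oi) in ia].
  exists ((nseq B west ++ nseq (15 * Q) south ++ flatten (nseq a (row_pair B Q)))
     ++ nseq (2 * B) east ++ nseq (2 * Q) north),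
    (nseq (2 * Q) north ++ flatten (nseq (7 - a) (row_pair B Q))), true.
  split; first by rewrite /row_pair -!catA.
  - rewrite !drift_cat !drift_nseq drift_flatten_nseq drift_row_pair !dirE.
    by rewrite !axisD !axisMn /axis /=; lia.
  - rewrite !drift_cat !drift_nseq drift_flatten_nseq drift_row_pair !dirE.
    by rewrite !axisD !axisMn /axis /=; lia.
exists (nseq B west ++ nseq (15 * Q) south ++ flatten (nseq a (row_pair B Q))),
  (nseq (2 * Q) north ++ nseq (2 * B) west ++ nseq (2 * Q) north ++
    flatten (nseq (7 - a) (row_pair B Q))), false.
split; first by rewrite /row_pair -!catA.
- rewrite !drift_cat !drift_nseq drift_flatten_nseq drift_row_pair !dirE.
  by rewrite !axisD !axisMn /axis /=; lia.
- rewrite !drift_cat !drift_nseq drift_flatten_nseq drift_row_pair !dirE.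
  by rewrite !axisD !axisMn /axis /=; lia.
Qed.

(** * Pathwise crossing of home *)

Lemma disp_cat l1 l2 es : (size l1 <= size es)%N ->
  disp (l1 ++ l2) es = disp l1 es + disp l2 (drop (size l1) es).
Proof.
elim: l1 es => [|d l1 IH] [|e es] //= s; rewrite ?add0r //.
by rewrite IH // addrA.
Qed.

Lemma hits_intro h z l es k : z + disp (take k l) es = h -> hits h z l es.
Proof.
elim: l es z k => [|d l IH] es z k; first by rewrite /= addr0 => ->; rewrite eqxx.
case: es => [|e es]; first by case: k => [|k] /=; rewrite addr0 => ->; rewrite eqxx.
case: k => [|k] /=; first by rewrite addr0 => ->; rewrite eqxx.
by rewrite addrA => /IH ->; rewrite orbT.
Qed.

Lemma axis_dir_bound c d : `|axis c (dir d)| <= 1.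
Proof. by elim/dir_ind: d; case: c; rewrite dirE. Qed.

Lemma disp_take_step c l es k :
  `|axis c (disp (take k.+1 l) es) - axis c (disp (take k l) es)| <= 1.
Proof.
elim: l es k => [|d l IH] [|e es] [|k] //=; rewrite ?subrr ?normr0 //.
- have -> : axis c 0 = 0 by case: (c).
  by rewrite take0 /= addr0 subr0 axis_dir_bound.
- by rewrite !axisD opprD addrACA subrr add0r.
Qed.

Lemma int_ivt (f : nat -> int) (v : int) n :
  (forall k, `|f k.+1 - f k| <= 1) ->
  (f 0%N <= v <= f n) || (f n <= v <= f 0%N) -> exists2 k, (k <= n)%N & f k = v.
Proof.
move=> fS; elim: n => [|n IH] H; first by exists 0%N => //; lia.
have [/IH[k kn fk]|H'] := boolP ((f 0%N <= v <= f n) || (f n <= v <= f 0%N)).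
  by exists k => //; exact: leq_trans kn _.
by exists n.+1 => //; have := fS n; lia.
Qed.

(** Only the instruction at index [j] differs, south becoming north: an error there erases the
    difference, obedience gives 2. *)
Lemma offset_step K j es : (j < K)%N -> size es = K ->
  disp (offset K j.+1) es = disp (offset K j) es \/
  disp (offset K j.+1) es = disp (offset K j) es + (0, 2).
Proof.
move=> jK ses.
have -> : offset K j.+1 = nseq j north ++ north :: nseq (K - j.+1) south.
  by rewrite /offset -(addn1 j) nseqD -catA.
have -> : offset K j = nseq j north ++ south :: nseq (K - j.+1) south.
  by rewrite /offset -[(K - j)%N](subnSK jK).
rewrite !disp_cat ?size_nseq ?ses 1?ltnW //.
have -> : drop j es = nth None es j :: drop j.+1 es by rewrite -drop_nth ?ses.
rewrite /=; case: (nth None es j) => [d|]; first by left.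
right; rewrite /move /= !dirE -!addrA; congr (_ + _).
by rewrite [RHS]addrCA [LHS]addrC.
Qed.

(** As [j] grows the height stays or jumps by 2, so it meets [v] or [v - 1]; a start one unit
    further north serves the second case. *)
Lemma offset_hit K (u v : int) es : size es = K ->
  u + (disp (nseq K south) es).2 + 1 <= v <= u + (disp (nseq K north) es).2 ->
  exists2 j, (j <= K)%N &
    (disp (offset K j) es).1 = (disp (nseq K north) es).1 /\
    (u + (disp (offset K j) es).2 = v \/ u + (disp (offset K j) es).2 + 1 = v).
Proof.
move=> ses.
have -> : nseq K south = offset K 0 by rewrite /offset subn0.
have -> : nseq K north = offset K K by rewrite /offset subnn cats0.
have H1 j : (j <= K)%N -> (disp (offset K j) es).1 = (disp (offset K 0) es).1.
  elim: j => // j IH jK; rewrite -IH; last exact: ltnW.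
  by case: (offset_step K j es jK ses) => -> //=; rewrite addr0.
move=> H; suff [j jK Hj] : exists2 j, (j <= K)%N &
    u + (disp (offset K j) es).2 = v \/ u + (disp (offset K j) es).2 + 1 = v.
  by exists j => //; split=> //; rewrite !H1.
move/andP: H => [H0 HK].
suff main n : (n <= K)%N -> v <= u + (disp (offset K n) es).2 -> exists2 j, (j <= n)%N &
    u + (disp (offset K j) es).2 = v \/ u + (disp (offset K j) es).2 + 1 = v.
  exact: main (leqnn K) HK.
elim: n => [|n IH] nK Hn; first by exists 0%N => //; lia.
have [/(IH (ltnW nK))[j jn Hj]|Hn'] := boolP (v <= u + (disp (offset K n) es).2).
  by exists j => //; exact: leqW.
case: (offset_step K n es nK ses) => E; rewrite E in Hn; first by lia.
have [Hv|Hv] := eqVneq (u + (disp (offset K n) es).2 + 1) v.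
  by exists n; [exact: leqnSn|right].
by exists n.+1 => //; left; rewrite E /=; move: Hn => /=; lia.
Qed.

(** Intervals of radius [t] around [m + 1] centres spaced [2 t] apart cover an interval of radius
    [(m + 1) t]. *)
Lemma near_row (R : realType) (m : nat) (a t : R) :
  0 <= t -> - ((m.+1)%:R * t) <= a <= m.+1%:R * t ->
  exists2 i, (i <= m)%N & `|a + ((2 * i)%:R - m%:R) * t| <= t.
Proof.
move=> t0; elim: m a => [|m IH] a /andP[H1 H2].
  by exists 0%N => //; rewrite ler_norml; apply/andP; split; lra.
have [am|am] := leP a (m%:R * t).
  have [|i im Hi] := IH (a + t).
    move: H1; rewrite -[m.+2%:R]natr1 -natr1 => H1; apply/andP; split; lra.
  exists i.+1 => //; rewrite (_ : _ + _ = a + t + ((2 * i)%:R - m%:R) * t) //.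
  by rewrite mulnS natrD -[m.+1%:R]natr1; ring.
exists 0%N => //; move: H2; rewrite -[m.+2%:R]natr1 -[m.+1%:R]natr1 ler_norml => H2.
by apply/andP; split; lra.
Qed.

Lemma disp_take l es : disp l (take (size l) es) = disp l es.
Proof. by elim: l es => [|d l IH] [|e es] //=; rewrite IH. Qed.

Lemma axis_intr (R : realType) (p : R) c l es :
  (axis c (disp l es))%:~R = centered p c l es + (1 - p) * (axis c (drift l))%:~R.
Proof. by rewrite /centered subrK. Qed.

Lemma snake_crossing (R : realType) (p rho : R) (K B Q : nat) (z h : pt) es :
  0 <= p <= 1 -> (K <= size es)%N ->
  (forall k c, `|centered p c (take k (nseq K north ++ snake B Q)) es| <= rho) ->
  (forall k c, `|centered p c (take k (nseq K south ++ snake B Q)) es| <= rho) ->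
  `|(z.1 - h.1)%:~R| <= (1 - p) * B%:R - rho ->
  `|(z.2 - h.2)%:~R| <= 16 * ((1 - p) * Q%:R) ->
  (1 - p) * Q%:R + rho + 1 <= (1 - p) * K%:R ->
  exists k, let s := z + disp (take k (snake B Q)) (drop K es) in
    s.1 + (disp (nseq K north) es).1 = h.1 /\
    s.2 + (disp (nseq K south) es).2 + 1 <= h.2 <= s.2 + (disp (nseq K north) es).2.
Proof.
move=> /andP[p0 p1] Kes GU GD Hz1 Hz2 HK.
have P0 : 0 <= 1 - p by lra.
have [i i15 Hi] : exists2 i, (i <= 15)%N &
    `|(z.2 - h.2)%:~R + ((2 * i)%:R - 15%:R) * ((1 - p) * Q%:R)| <= (1 - p) * Q%:R.
  apply: near_row; first by rewrite mulr_ge0.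
  by move: Hz2; rewrite ler_norml.
have [pre [post [s [Es D1 D2]]]] := snake_row B Q i i15.
set d := if s then west else east in Es.
have takeE (l : seq 'I_4) k : size l = K -> (k <= 2 * B)%N ->
    take (K + (size pre + k)) (l ++ snake B Q) = l ++ pre ++ nseq k d.
  move=> sl kB; rewrite Es take_cat sl ltnNge leq_addr /= addKn take_cat.
  rewrite ltnNge leq_addr /= addKn take_cat size_nseq.
  case: ltnP => [kB'|Bk]; first by rewrite take_nseq.
  by rewrite (_ : k = (2 * B)%N) ?subnn ?take0 ?cats0 //; apply/eqP; rewrite eqn_leq kB.
have dispE (l : seq 'I_4) k : size l = K -> 
    disp (take (K + k) (l ++ snake B Q)) es = disp l es + disp (take k (snake B Q)) (drop K es).
  by move=> sl; rewrite take_cat sl ltnNge leq_addr /= addKn disp_cat sl.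
pose f k := axis false (z + disp (take (K + (size pre + k)) (nseq K north ++ snake B Q)) es).
have fS k : `|f k.+1 - f k| <= 1.
  rewrite /f !axisD opprD addrACA subrr add0r !addnS; exact: disp_take_step.
have axd : axis false (dir d) = if s then -1 else 1 by rewrite /d; case: (s); rewrite dirE.
have axd2 : axis true (dir d) = 0 by rewrite /d; case: (s); rewrite dirE.
have fE k : (k <= 2 * B)%N -> (f k - h.1)%:~R = (z.1 - h.1)%:~R
    + centered p false (take (K + (size pre + k)) (nseq K north ++ snake B Q)) es
    + (1 - p) * (if s then B%:R - k%:R else k%:R - B%:R) :> R.
  move=> kB; have -> : f k - h.1 = (z.1 - h.1) +
      axis false (disp (take (K + (size pre + k)) (nseq K north ++ snake B Q)) es).
    by rewrite /f axisD /axis addrAC.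
  rewrite intrD (axis_intr _ p) addrA; congr (_ + (1 - p) * _).
  rewrite takeE ?size_nseq // !drift_cat !drift_nseq !axisD !axisMn D1 axd dirE.
  by rewrite /axis /= mul0rn add0r; case: (s); ring.
(* The mean positions of the two ends of the row are [(1 - p) B] to either side of [z], which leaves
   room [rho] for the deviation beyond home. *)
have [k kB fk] : exists2 k, (k <= 2 * B)%N & f k = h.1.
  apply: int_ivt => //.
  have := fE 0%N isT; have := fE (2 * B)%N (leqnn _).
  have := GU (K + (size pre + 0))%N false; have := GU (K + (size pre + 2 * B))%N false.
  move: Hz1; rewrite !ler_norml natrM; set x0 := centered _ _ _ _; set x1 := centered _ _ _ _.
  move=> /andP[? ?] /andP[? ?] /andP[? ?]; case: (s) => E1 E0; apply/orP; [right|left];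
    rewrite -![_ <= h.1]subr_le0 -![h.1 <= _]subr_ge0 -![_ <= 0 :> int](ler_int R)
            -![0 <= _ :> int](ler_int R) E0 E1; apply/andP; split; lra.
exists (size pre + k)%N => /=; split.
  by move: fk; rewrite /f dispE ?size_nseq // /axis /= => <-; rewrite addrA addrAC.
have vE (l : seq 'I_4) b : size l = K -> 
    (z.2 + (disp (take (size pre + k) (snake B Q)) (drop K es)).2 + (disp l es).2 - h.2)%:~R
    = (z.2 - h.2)%:~R + centered p true (take (K + (size pre + k)) (l ++ snake B Q)) es
      + (1 - p) * ((axis true (drift l))%:~R + ((2 * i)%:R - 15%:R) * Q%:R) + b - b :> R.
  move=> sl; rewrite addrK.
  have -> : z.2 + (disp (take (size pre + k) (snake B Q)) (drop K es)).2 + (disp l es).2 - h.2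
     = (z.2 - h.2) + axis true (disp (take (K + (size pre + k)) (l ++ snake B Q)) es).
    by rewrite dispE // /axis /=; ring.
  rewrite intrD (axis_intr _ p) addrA; congr (_ + (1 - p) * _).
  rewrite takeE // !drift_cat drift_nseq !axisD axisMn axd2 D2 mul0rn addr0 intrD.
  by rewrite intrB !intrM -!pmulrn; ring.
have EU : axis true (drift (nseq K north)) = K%:Z by rewrite drift_nseq axisMn dirE /axis /=; lia.
have ED : axis true (drift (nseq K south)) = - K%:Z by rewrite drift_nseq axisMn dirE /axis /=; lia.
have := GU (K + (size pre + k))%N true; have := GD (K + (size pre + k))%N true.
move: Hi; rewrite !ler_norml => /andP[? ?] /andP[? ?] /andP[? ?].
apply/andP; split.
  rewrite -subr_le0 -(ler_int R) addrAC intrD (vE _ 0) ?size_nseq // ED mulrNz -pmulrn.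
  lra.
rewrite -subr_ge0 -(ler_int R) (vE _ 0) ?size_nseq // EU -pmulrn; lra.
Qed.

Lemma size_offset K j : (j <= K)%N -> size (offset K j) = K.
Proof. by move=> jK; rewrite size_cat !size_nseq subnKC. Qed.

(** The second start, one unit further north, compensates for the offsets moving in jumps of 2. *)
Definition search_hits (h z : pt) (K B Q j : nat) (es : seq noise) : nat :=
  hits h z (offset K j ++ snake B Q) es +
  hits h (z + (0, 1)) (offset K j ++ snake B Q) es.

(** The two extreme offsets suffice: intermediate ones are reached from them by [offset_hit]. *)
Definition deviation4 {R : realType} (p : R) (K B Q k : nat) (es : seq noise) : R :=
  \sum_(l <- [:: nseq K north; nseq K south]) \sum_(c <- [:: true; false])
    centered p c (take k (l ++ snake B Q)) es ^+ 4.

Lemma deviation4_le (R : realType) (p rho : R) (K B Q k : nat) es l c :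
  0 <= rho -> deviation4 p K B Q k es <= rho ^+ 4 ->
  l \in [:: nseq K north; nseq K south] ->
  `|centered p c (take k (l ++ snake B Q)) es| <= rho.
Proof.
move=> rho0 Hd ll; rewrite -(@ler_pXn2r _ 4) ?nnegrE ?normr_ge0 //.
apply: le_trans Hd; rewrite -normrX ger0_norm ?exprn_even_ge0 // /deviation4.
have x0 l' c' : 0 <= centered p c' (take k (l' ++ snake B Q)) es ^+ 4.
  by rewrite exprn_even_ge0.
rewrite !big_cons !big_nil; move: ll; rewrite !inE.
have := x0 (nseq K north) true; have := x0 (nseq K north) false.
have := x0 (nseq K south) true; have := x0 (nseq K south) false.
by case: c => ? ? ? ? /orP[] /eqP ->; lra.
Qed.

Lemma search_hits_ge1 (R : realType) (p rho : R) (K B Q : nat) (z h : pt) es :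
  0 <= p <= 1 -> 0 <= rho -> size es = (K + size (snake B Q))%N ->
  `|(z.1 - h.1)%:~R| <= (1 - p) * B%:R - rho ->
  `|(z.2 - h.2)%:~R| <= 16 * ((1 - p) * Q%:R) ->
  (1 - p) * Q%:R + rho + 1 <= (1 - p) * K%:R ->
  (forall k, (k <= K + size (snake B Q))%N -> deviation4 p K B Q k es <= rho ^+ 4) ->
  (0 < \sum_(j < K.+1) search_hits h z K B Q j es)%N.
Proof.
move=> p01 rho0 ses Hz1 Hz2 HK dev.
have G l k c : l \in [:: nseq K north; nseq K south] ->
    `|centered p c (take k (l ++ snake B Q)) es| <= rho.
  move=> ll; have sl : size l = K.
    by move: ll; rewrite !inE => /orP[] /eqP ->; rewrite size_nseq.
  have [kn|nk] := leqP k (K + size (snake B Q)).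
    by apply: (deviation4_le _ _ _ K) => //; exact: dev.
  (* Beyond the end [take] returns the whole path, which the last index already covers. *)
  have -> : take k (l ++ snake B Q) = take (K + size (snake B Q)) (l ++ snake B Q).
    by rewrite !take_oversize // size_cat sl // ltnW.
  by apply: (deviation4_le _ _ _ K) => //; exact: dev.
have Kes : (K <= size es)%N by rewrite ses leq_addr.
have south_in : nseq K south \in [:: nseq K north; nseq K south].
  by rewrite !inE eqxx orbT.
have [k] := snake_crossing _ p rho K B Q z h es p01 Kes
  (fun k c => G _ k c (mem_head _ _)) (fun k c => G _ k c south_in)
  Hz1 Hz2 HK.
set s := z + _ => -[s1 s2].
have dK d : disp (nseq K d) es = disp (nseq K d) (take K es).
  by rewrite -[in take K es](size_nseq K d) disp_take.
rewrite !dK in s1 s2.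
have [|j jK [j1 j2]] := offset_hit K s.2 h.2 (take K es) _ s2.
  by rewrite size_takel.
have := disp_take (offset K j) es; rewrite size_offset // => dj; rewrite dj in j1 j2.
(* Under fixed noise, changing the offset or the start only translates the snake. *)
have pos y : y + disp (take (K + k) (offset K j ++ snake B Q)) es =
    y - z + (s + disp (offset K j) es).
  rewrite take_cat size_offset // ltnNge leq_addr /= addKn disp_cat size_offset //.
  by rewrite /s -!addrA addKr [X in _ = _ + X]addrC.
rewrite lt0n sum_nat_eq0 negb_forall; apply/existsP; exists (inord j).
rewrite inordK //= /search_hits addn_eq0 !eqb0 negb_and !negbK.
apply/orP; case: j2 => j2; [left|right]; apply: (hits_intro _ _ _ _ (K + k)); rewrite pos.
  rewrite subrr add0r [LHS]surjective_pairing /= j1 s1 j2.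
  by case: (h).
rewrite [z + _]addrC addrK [LHS]surjective_pairing /= j1 s1 add0r.
by rewrite addrC j2; case: (h).
Qed.

Lemma expect_deviation4 (R : realType) (p : R) (K B Q k n : nat) :
  0 <= p <= 1 -> n = (K + size (snake B Q))%N -> (k <= n)%N ->
  expect p n (deviation4 p K B Q k) <= 1000 * n%:R ^+ 2.
Proof.
move=> p01 nE kn.
have M l c : size l = K -> expect p n (fun es =>
     centered p c (take k (l ++ snake B Q)) es ^+ 4) <= 250 * n%:R ^+ 2.
  move=> sl; have sz : size (take k (l ++ snake B Q)) = k.
    by rewrite size_takel // size_cat sl -nE.
  have := moment4 _ p 0 c (take k (l ++ snake B Q)) n p01; rewrite sz => /(_ kn).
  under eq_expect do rewrite add0r.
  move/le_trans; apply; rewrite !expr0n /= mulr0 !add0r ler_wpM2l //.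
  by rewrite lerXn2r ?nnegrE ?ler0n // ler_nat.
rewrite /deviation4 expect_sum !big_cons big_nil !expect_sum !big_cons !big_nil.
have := M (nseq K north) true (size_nseq _ _).
have := M (nseq K north) false (size_nseq _ _).
have := M (nseq K south) true (size_nseq _ _).
have := M (nseq K south) false (size_nseq _ _).
lra.
Qed.

(** Markov's inequality for fourth powers and a union bound over the [n + 1] prefixes, both
    contained in one pathwise lower bound on the number of hits. *)
Lemma search_hit_prob (R : realType) (p rho : R) (K B Q : nat) (z h : pt) :
  let n := (K + size (snake B Q))%N in
  0 <= p <= 1 -> 0 < rho ->
  `|(z.1 - h.1)%:~R| <= (1 - p) * B%:R - rho ->
  `|(z.2 - h.2)%:~R| <= 16 * ((1 - p) * Q%:R) ->
  (1 - p) * Q%:R + rho + 1 <= (1 - p) * K%:R ->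
  1 - 1000 * n.+1%:R * n%:R ^+ 2 / rho ^+ 4 <=
  \sum_(j < K.+1) ((1 - surv p h (offset K j ++ snake B Q) (fun=> 1) z) +
                   (1 - surv p h (offset K j ++ snake B Q) (fun=> 1) (z + (0, 1)))).
Proof.
move=> n p01 rho0 Hz1 Hz2 HK; have nE : n = (K + size (snake B Q))%N by []; clearbody n.
have rho4 : 0 < rho ^+ 4 by rewrite exprn_gt0.
have -> : \sum_(j < K.+1) ((1 - surv p h (offset K j ++ snake B Q) (fun=> 1) z) +
     (1 - surv p h (offset K j ++ snake B Q) (fun=> 1) (z + (0, 1)))) =
   expect p n (fun es => \sum_(j < K.+1) (search_hits h z K B Q j es)%:R).
  rewrite expect_sum; apply: eq_bigr => j _; rewrite -!expect_hits -expectD.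
  have -> : size (offset K j ++ snake B Q) = n.
    by rewrite size_cat size_offset -?nE //; exact: (ltn_ord j).
  by apply: eq_expect => es _; rewrite natrD.
apply: (@le_trans _ _ (expect p n (fun es =>
   1 + (- (rho ^+ 4)^-1) * \sum_(k < n.+1) deviation4 p K B Q k es))).
  rewrite expectD expect_cst expectZ expect_sum mulNr lerD2l lerN2 mulrC.
  rewrite ler_wpM2r ?invr_ge0 ?(ltW rho4) //.
  apply: (@le_trans _ _ (\sum_(k < n.+1) (1000 * n%:R ^+ 2))).
    by apply: ler_sum => k _; apply: expect_deviation4 => //; exact: (ltn_ord k).
  by rewrite sumr_const card_ord -[leLHS]mulr_natl mulrCA mulrA.
apply: le_expect => // es ses.
have D0 k : 0 <= deviation4 p K B Q k es.
  by rewrite /deviation4 sumr_ge0 // => l _; rewrite sumr_ge0 // => c _; rewrite exprn_even_ge0.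
rewrite -natr_sum.
have [/forallP dev|/forallPn[k]] :=
  boolP [forall k : 'I_n.+1, deviation4 p K B Q k es <= rho ^+ 4].
  apply: (@le_trans _ _ 1).
    by rewrite gerDl mulNr oppr_le0 mulr_ge0 ?sumr_ge0 // invr_ge0 ltW.
  rewrite ler1n; apply: search_hits_ge1 Hz1 Hz2 HK _; rewrite -?nE // ?ltW //.
  by move=> k kn; have := dev (Ordinal (kn : (k < n.+1)%N)).
(* Some deviation exceeds the threshold, so the lower bound is nonpositive. *)
rewrite -ltNge => dk; apply: le_trans (ler0n _ _).
rewrite mulNr subr_le0 ler_pdivlMl // mulr1 (bigD1 k) //=.
by rewrite (le_trans (ltW dk)) // lerDl sumr_ge0.
Qed.

(** * One round *)

(* The scale factor 50 and the multiples 9, 185, 8 used in [round] balance the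
   growth of [energy] against the hitting probability for all [p <= 3/250]. *)
Definition unit_size (n : nat) : nat := (n %/ 50)%N.

Definition choices (n : nat) : nat := (2 * (9 * unit_size n).+1)%N.

(** The search has drift [(- B, 17 Q + 2 j - K)]; the remaining pieces cancel it and make the total
    length independent of [j <= K]. *)
Definition tour (K B Q j : nat) : seq 'I_4 :=
  (offset K j ++ snake B Q) ++
  nseq B east ++ nseq (17 * Q) south ++ nseq (K - j) north ++ nseq j south.

(* The parity of [i] decides whether an extra step north comes first or only
   at the end; this makes both parities of the vertical coordinate reachable. *)
Definition round (n i : nat) : seq 'I_4 :=
  let q := unit_size n in
  let l := tour (9 * q) (185 * q) (8 * q) i./2 in
  if odd i then north :: l ++ [:: south] else l ++ [:: north; south].

(** Per unit, [62 * 110 = 2 * 9 + 34 * 185 + 64 * 8]; the 2 counts the extra steps north and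
    south. *)
Definition round_length (n : nat) : nat := (62 * (110 * unit_size n) + 2)%N.

Lemma half_choices n i : (i < choices n)%N -> (i./2 <= 9 * unit_size n)%N.
Proof. by rewrite /choices => ?; lia. Qed.

Lemma size_snake B Q : size (snake B Q) = (33 * B + 47 * Q)%N.
Proof.
rewrite /snake size_cat size_cat size_flatten /shape map_nseq sumn_nseq.
by rewrite /row_pair !size_cat !size_nseq; lia.
Qed.

Lemma size_tour K B Q j : (j <= K)%N ->
  size (tour K B Q j) = (2 * K + 34 * B + 64 * Q)%N.
Proof.
move=> jK; rewrite /tour size_cat (size_cat (offset _ _)) size_offset // size_snake.
by rewrite !size_cat !size_nseq; lia.
Qed.

Lemma size_round n i : (i < choices n)%N -> size (round n i) = round_length n.
Proof.
move=> /half_choices iq; rewrite /round /round_length.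
by case: ifP => _; rewrite /= size_cat size_tour //=; lia.
Qed.

Lemma drift_snake B Q :
  (axis false (drift (snake B Q)) = - B%:Z) * (axis true (drift (snake B Q)) = 17 * Q%:Z).
Proof.
by split; rewrite /snake drift_cat drift_cat drift_flatten_nseq drift_row_pair !drift_nseq
  !axisD !axisMn !dirE /axis /=; lia.
Qed.

Lemma drift_tour K B Q j c : (j <= K)%N -> axis c (drift (tour K B Q j)) = 0.
Proof.
move=> jK; rewrite /tour drift_cat (drift_cat (offset _ _)) axisD axisD.
by case: c; rewrite drift_snake /offset !drift_cat !drift_nseq !axisD !axisMn !dirE /axis /=; lia.
Qed.

Lemma drift_round n i c : (i < choices n)%N -> axis c (drift (round n i)) = 0.
Proof.
move=> /half_choices iq; rewrite /round.
have d0 : drift [::] = 0 by rewrite /drift big_nil.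
by case: ifP => _; rewrite ?drift_cons drift_cat !axisD drift_tour // !drift_cons d0
  !axisD !dirE; case: c; rewrite /axis /=; lia.
Qed.

Lemma path_var_cat (R : realType) (p : R) c l1 l2 :
  path_var p c (l1 ++ l2) = path_var p c l1 + path_var p c l2.
Proof. exact: big_cat. Qed.

Lemma path_var_cons (R : realType) (p : R) c d l :
  path_var p c (d :: l) = step_var p c d + path_var p c l.
Proof. exact: big_cons. Qed.

Lemma path_var_nseq (R : realType) (p : R) c d n :
  path_var p c (nseq n d) = n%:R * step_var p c d.
Proof. by rewrite /path_var big_nseq iter_addr_0 mulr_natl. Qed.

Lemma step_varE (R : realType) (p : R) :
  ((step_var p false east = p * (3 / 2)) * (step_var p false west = p * (3 / 2)) *
   (step_var p false north = p / 2) * (step_var p false south = p / 2)) *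
  ((step_var p true east = p / 2) * (step_var p true west = p / 2) *
   (step_var p true north = p * (3 / 2)) * (step_var p true south = p * (3 / 2))).
Proof. by rewrite /step_var !dirE. Qed.

Lemma path_var_flatten_nseq (R : realType) (p : R) c n l :
  path_var p c (flatten (nseq n l)) = n%:R * path_var p c l.
Proof.
elim: n => [|n IH] /=; first by rewrite /path_var big_nil mul0r.
by rewrite path_var_cat IH -natr1; ring.
Qed.

Lemma path_var_snake (R : realType) (p : R) c B Q :
  path_var p c (snake B Q) =
  p * (if c then 33 / 2 * B%:R + 141 / 2 * Q%:R else 99 / 2 * B%:R + 47 / 2 * Q%:R).
Proof.
rewrite /snake path_var_cat path_var_cat path_var_flatten_nseq !path_var_nseq.
rewrite /row_pair !path_var_cat !path_var_nseq.
by case: c; rewrite !step_varE !natrM; field.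
Qed.

Lemma path_var_tour (R : realType) (p : R) c K B Q j : (j <= K)%N ->
  path_var p c (tour K B Q j) =
  p * (if c then 17 * B%:R + 96 * Q%:R + 3 * K%:R else 51 * B%:R + 32 * Q%:R + K%:R).
Proof.
move=> jK; rewrite /tour path_var_cat (path_var_cat _ _ _ (offset _ _)) path_var_snake.
rewrite /offset path_var_cat !path_var_cat !path_var_nseq natrB //.
by case: c; rewrite !step_varE !natrM; field.
Qed.

Lemma path_var_round (R : realType) (p : R) c n i : (i < choices n)%N ->
  path_var p c (round n i) =
  p * (if c then 394 * 10 * (unit_size n)%:R + 3 else 97 * 100 * (unit_size n)%:R + 1).
Proof.
move=> /half_choices iq; rewrite /round.
have v0 : path_var p c [::] = 0 by rewrite /path_var big_nil.
case: ifP => _; rewrite ?path_var_cons path_var_cat path_var_tour // ?path_var_cons v0;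
  by case: c {v0}; rewrite !step_varE !natrM; field.
Qed.

(** The numerator of the Lyapunov function [V]; its denominator [n (n + 1)] enters in
    [sum_mean_surv]. *)
Definition energy {R : realType} (h : pt) (n : nat) (z : pt) : R :=
  n%:R ^+ 4 + 29 / 20 / 100 * (z.1 - h.1)%:~R ^+ 4 + 7 / 125 * (z.2 - h.2)%:~R ^+ 4.

Lemma energy_ge (R : realType) h n z : n%:R ^+ 4 <= energy h n z :> R.
Proof.
rewrite /energy -addrA lerDl addr_ge0 // mulr_ge0 // ?exprn_even_ge0 //; lra.
Qed.

Definition energy_bound {R : realType} (p : R) (h : pt) (n : nat) (z : pt) : R :=
  let bound (x v : R) := x ^+ 4 + 61 / 10 * (p * v) * x ^+ 2 + 250 * (round_length n)%:R ^+ 2 in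
  n.+1%:R ^+ 4
  + 29 / 20 / 100 * bound (z.1 - h.1)%:~R (97 * 100 * (unit_size n)%:R + 1)
  + 7 / 125 * bound (z.2 - h.2)%:~R (394 * 10 * (unit_size n)%:R + 3).

Lemma expect_energy (R : realType) (p : R) h n i z :
  0 <= p <= 1 -> (i < choices n)%N ->
  expect p (size (round n i)) (fun es => energy h n.+1 (z + disp (round n i) es))
  <= energy_bound p h n z.
Proof.
move=> p01 ic; have sz := size_round n i ic.
have disp_axis c es : (axis c (disp (round n i) es))%:~R = centered p c (round n i) es.
  by rewrite /centered drift_round // mulr0 subr0.
have M c a := moment4 _ p a c (round n i) _ p01 (leqnn _).
have := M false (z.1 - h.1)%:~R; have := M true (z.2 - h.2)%:~R.
rewrite !path_var_round // sz /energy_bound.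
set E1 := expect _ _ _; set E2 := expect _ _ _ => H1 H2.
have -> : expect p (round_length n) (fun es => energy h n.+1 (z + disp (round n i) es)) =
    n.+1%:R ^+ 4 + 29 / 20 / 100 * E2 + 7 / 125 * E1.
  rewrite /E1 /E2 -!expectZ -[X in X + _ + _](expect_cst _ p _ (round_length n)) -!expectD.
  apply: eq_expect => es _; rewrite /energy -!disp_axis /axis /=.
  by rewrite -!intrD ![_ + _ - _]addrAC.
by rewrite -!addrA lerD2l lerD // ler_wpM2l //; lra.
Qed.

(** * Hitting probability and energy decrease in one round *)

Lemma surv_catl (R : realType) (p : R) h l1 l2 z :
  0 <= p <= 1 -> surv p h (l1 ++ l2) (fun=> 1) z <= surv p h l1 (fun=> 1) z.
Proof. by move=> p01; rewrite surv_cat le_surv // => y; exact: surv_le1. Qed.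

Lemma surv_north (R : realType) (p : R) h l z : 0 <= p <= 1 ->
  surv p h (north :: l) (fun=> 1) z <= p + (1 - p) * surv p h l (fun=> 1) (z + (0, 1)).
Proof.
move=> p01; have /andP[p0 p1] := p01; rewrite [surv _ _ _ _ _]/=; case: eqP => _.
  by rewrite addr_ge0 // mulr_ge0 ?subr_ge0 // surv_ge0.
rewrite /mean /move /= dirE addrC lerD2r.
apply: (@le_trans _ _ (p / 4 * \sum_(d < 4) 1)).
  by rewrite ler_wpM2l ?divr_ge0 // ler_sum // => d _; exact: surv_le1.
by rewrite sumr_const card_ord divfK.
Qed.

Lemma sum_double (V : nmodType) (F : nat -> V) m :
  \sum_(i < 2 * m) F i = \sum_(j < m) (F (2 * j)%N + F (2 * j).+1).
Proof.
elim: m => [|m IH]; first by rewrite muln0 !big_ord0.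
by rewrite mulnS !big_ord_recr /= IH addrA.
Qed.

Definition search (n j : nat) : seq 'I_4 :=
  offset (9 * unit_size n) j ++ snake (185 * unit_size n) (8 * unit_size n).

Lemma round_even n j : exists l, round n (2 * j) = search n j ++ l.
Proof.
eexists; rewrite /round oddM [LHS]/= mul2n doubleK /tour -[LHS]catA; reflexivity.
Qed.

Lemma round_odd n j : exists l, round n (2 * j).+1 = north :: search n j ++ l.
Proof.
eexists; rewrite /round oddS oddM [LHS]/= mul2n uphalf_double /tour -[X in north :: X]catA.
reflexivity.
Qed.

(** Even choices search from [z]; odd ones search from [z + (0, 1)] if the initial step north is
    obeyed, which costs the factor [1 - p]. *)
Lemma sum_round_hits (R : realType) (p : R) h n z : 0 <= p <= 1 ->
  (1 - p) * (\sum_(j < (9 * unit_size n).+1) ((1 - surv p h (search n j) (fun=> 1) z) +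
                   (1 - surv p h (search n j) (fun=> 1) (z + (0, 1)))))
  <= \sum_(i < choices n) (1 - surv p h (round n i) (fun=> 1) z).
Proof.
move=> p01; have /andP[p0 p1] := p01.
rewrite /choices (sum_double _ (fun i => 1 - surv p h (round n i) (fun=> 1) z)).
rewrite mulr_sumr; apply: ler_sum => j _; rewrite mulrDr; apply: lerD.
  have [l ->] := round_even n j.
  have := surv_catl _ p h (search n j) l z p01.
  have : 0 <= p * (1 - surv p h (search n j) (fun=> 1) z).
    by rewrite mulr_ge0 // subr_ge0 surv_le1.
  lra.
have [l ->] := round_odd n j.
have := surv_north _ p h (search n j ++ l) z p01.
have := surv_catl _ p h (search n j) l (z + (0, 1)) p01.
move: (surv _ _ _ _ _) => s1; move: (surv _ _ _ _ _) => s2; move: (surv _ _ _ _ _) => s3.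
have : 0 <= 1 - p by lra.
nra.
Qed.

(** This is [search_hit_prob] with [rho = q / 2] and path length [6490 q], rounded up to [6500 q].
    For [p <= 3/250], [185 (1 - p) - 1/2 >= 182] and [128 (1 - p) >= 632/5]. *)
Lemma round_hit_prob (R : realType) (p : R) h n z :
  let q : R := (unit_size n)%:R in
  0 <= p -> p <= 3 / 250 -> 100 <= q ->
  `|(z.1 - h.1)%:~R| <= 182 * q -> `|(z.2 - h.2)%:~R| <= 632 / 5 * q ->
  (1 - p) * (1 - 16 * 10 ^+ 3 * (65 * 100) ^+ 3 / q)
  <= \sum_(i < choices n) (1 - surv p h (round n i) (fun=> 1) z).
Proof.
move=> q p0 p1 q100 H1 H2; have p01 : 0 <= p <= 1 by apply/andP; split; lra.
apply: le_trans (sum_round_hits _ p h n z p01).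
apply: ler_wpM2l; first lra.
have q0 : 0 < q by lra.
have := @search_hit_prob R p (q / 2) (9 * unit_size n) (185 * unit_size n)
  (8 * unit_size n) z h p01.
have -> : (9 * unit_size n + size (snake (185 * unit_size n) (8 * unit_size n)) =
   55 * (118 * unit_size n))%N by rewrite size_snake; lia.
rewrite -[(55 * _).+1%:R]natr1 !natrM -/q => H; apply: le_trans (H _ _ _ _); last 4 first.
- lra.
- apply: le_trans H1 _; nra.
- apply: le_trans H2 _; nra.
- nra.
rewrite lerD2l lerN2 ler_pdivrMr ?exprn_gt0 ?divr_gt0 //.
have -> : 16 * 10 ^+ 3 * (65 * 100) ^+ 3 / q * (q / 2) ^+ 4 =
    1000 * (65 * 100 * q) * (65 * 100 * q) ^+ 2 by field; rewrite lt0r_neq0.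
have q65 : 55 * (118 * q) + 1 <= 65 * 100 * q by lra.
rewrite ler_pM ?sqr_ge0 ?mulr_ge0 ?ler_wpM2l ?ler0n //; first by lra.
rewrite lerXn2r ?nnegrE ?mulr_ge0 ?ler0n ?(ltW q0) //; lra.
Qed.

(* In terms of [y = x / n^2], the left-hand side divided by [n^3] is at most
   2.62, and negative once [y1 >= 3.63^2] or [y2 >= 2.52^2]; the weights 29/2000
   and 7/125 of [energy] were tuned for this. *)
Lemma energy_balance (R : realType) (n v1 v2 x1 x2 k : R) :
  0 < n -> 0 <= x1 -> 0 <= x2 -> v1 <= 233 / 100 * n -> v2 <= 473 / 500 * n ->
  0 <= k ->
  27 / 10 * n ^+ 3 <= k \/ (363 / 100 * n) ^+ 2 <= x1 \/ (63 / 25 * n) ^+ 2 <= x2 ->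
  101 / 50 * n ^+ 3 + 29 / 20 / 100 * (61 / 10 * v1 * x1 - 2 * x1 ^+ 2 / n)
    + 7 / 125 * (61 / 10 * v2 * x2 - 2 * x2 ^+ 2 / n) <= k.
Proof.
move=> n0; have n_neq0 : n != 0 by rewrite gt_eqF.
have -> : x1 = n ^+ 2 * (x1 / n ^+ 2) by field.
have -> : x2 = n ^+ 2 * (x2 / n ^+ 2) by field.
move: (x1 / n ^+ 2) (x2 / n ^+ 2) => y1 y2.
have n2 : 0 < n ^+ 2 by rewrite exprn_gt0.
have n3 : 0 < n ^+ 3 by rewrite exprn_gt0.
rewrite !pmulr_rge0 // => y1_ge0 y2_ge0 v1_le v2_le k0 H.
pose g1 := 61 / 10 * (233 / 100) * y1 - 2 * y1 ^+ 2.
pose g2 := 61 / 10 * (473 / 500) * y2 - 2 * y2 ^+ 2.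
(* The parabolas [g1] and [g2] have their vertices near 3.55 and 1.44. *)
have G1 : g1 <= 253 / 10 by rewrite /g1; have := sqr_ge0 (y1 - 355 / 100); nra.
have G2 : g2 <= 417 / 100 by rewrite /g2; have := sqr_ge0 (y2 - 144 / 100); nra.
apply: (@le_trans _ _ (n ^+ 3 * (101 / 50 + 29 / 20 / 100 * g1 + 7 / 125 * g2))).
  have w1 : v1 * (n ^+ 2 * y1) <= 233 / 100 * n * (n ^+ 2 * y1).
    by rewrite ler_wpM2r // mulr_ge0 // ltW.
  have w2 : v2 * (n ^+ 2 * y2) <= 473 / 500 * n * (n ^+ 2 * y2).
    by rewrite ler_wpM2r // mulr_ge0 // ltW.
  have e1 : 2 * (n ^+ 2 * y1) ^+ 2 / n = 2 * n ^+ 3 * y1 ^+ 2 by field.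
  have e2 : 2 * (n ^+ 2 * y2) ^+ 2 / n = 2 * n ^+ 3 * y2 ^+ 2 by field.
  rewrite e1 e2 /g1 /g2; lra.
have [Hk|H12] := H.
  apply: le_trans Hk; rewrite mulrC ler_pM2r //; lra.
apply: le_trans k0; rewrite pmulr_rle0 //.
case: H12 => Hy.
  have y1_ge : (363 / 100) ^+ 2 <= y1.
    by rewrite -(ler_pM2l n2) -exprMn [n * _]mulrC.
  have : g1 <= - 159 by rewrite /g1; nra.
  lra.
have y2_ge : (63 / 25) ^+ 2 <= y2.
  by rewrite -(ler_pM2l n2) -exprMn [n * _]mulrC.
have : g2 <= - 44 by rewrite /g2; nra.
lra.
Qed.

(* From here on the error term of [round_hit_prob] is at most 1/100. *)
Definition onset {R : realType} : R := 10 ^+ 2 * (16 * 10 ^+ 3 * (65 * 100) ^+ 3).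

Lemma unit_size_bounds (R : realType) n :
  50 * (unit_size n)%:R <= n%:R :> R /\ n%:R - 49 <= 50 * (unit_size n)%:R :> R.
Proof.
split; first by rewrite -natrM ler_nat mulnC leq_divM.
rewrite lerBlDr -natrM -natrD ler_nat /unit_size; lia.
Qed.

Lemma le_sqr (R : realType) (x y : R) : 0 <= x -> x <= y -> x ^+ 2 <= y ^+ 2.
Proof. by move=> x0 xy; rewrite lerXn2r // nnegrE (le_trans x0). Qed.

(** To leading order [(n + 1)^4] exceeds [(1 + 2 / n) n^4] by [2 n^3]. Adding [n^3 / 100] for the
    claimed decrease and as much again for the lower-order terms gives the [101/50] of
    [energy_balance]. *)
Lemma energy_bound_le (R : realType) (p : R) h n z k :
  let q : R := (unit_size n)%:R in
  0 <= p -> p <= 3 / 250 -> onset <= q -> 0 <= k ->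
  27 / 10 * n%:R ^+ 3 <= k \/
    (182 * q) ^+ 2 <= (z.1 - h.1)%:~R ^+ 2 \/ (632 / 5 * q) ^+ 2 <= (z.2 - h.2)%:~R ^+ 2 ->
  energy_bound p h n z - k <= (1 + 2 / n%:R) * energy h n z - n%:R ^+ 3 / 100.
Proof.
move=> q p0 p1 hq k0 H; have [nq qn] := unit_size_bounds R n.
have onset_ge : 10 ^+ 8 <= onset :> R by rewrite /onset; lra.
rewrite /energy_bound /energy -(natr1 n); set L : R := (round_length n)%:R.
have LE : L = 62 * (110 * q) + 2 by rewrite /L /round_length natrD !natrM.
move: H; move: (z.1 - h.1)%:~R (z.2 - h.2)%:~R => a1 a2 H.
rewrite -/q in nq qn *; clearbody q L; move: (n%:R : R) nq qn H => m mq qm H.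
have m8 : 10 ^+ 8 <= m by lra.
clear hq onset_ge.
have m6 : 10 * 100 * 1000 <= m by lra.
have q1 : 1000 <= q by clear m8; lra.
have m0 : 0 < m by clear - m6; lra.
have pq1 : p * (97 * 100 * q + 1) <= 233 / 100 * m.
  apply: (@le_trans _ _ (3 / 250 * (97 * 100 * q + 1))).
    by apply: ler_wpM2r p1; clear - q1; lra.
  by clear - mq m6; lra.
have pq2 : p * (394 * 10 * q + 3) <= 473 / 500 * m.
  apply: (@le_trans _ _ (3 / 250 * (394 * 10 * q + 3))).
    by apply: ler_wpM2r p1; clear - q1; lra.
  by clear - mq m6; lra.
have H' : 27 / 10 * m ^+ 3 <= k \/
    (363 / 100 * m) ^+ 2 <= a1 ^+ 2 \/ (63 / 25 * m) ^+ 2 <= a2 ^+ 2.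
  have m_le1 : 363 / 100 * m <= 182 * q by clear - qm m6; lra.
  have m_le2 : 63 / 25 * m <= 632 / 5 * q by clear - qm m6; lra.
  have m_ge : 0 <= 363 / 100 * m /\ 0 <= 63 / 25 * m by clear - m0; split; lra.
  case: m_ge => g1 g2.
  case: H => [|[H|H]]; [by left| right; left | right; right]; apply: le_trans H.
    exact: le_sqr.
  exact: le_sqr.
have Hbal := energy_balance R m _ _ (a1 ^+ 2) (a2 ^+ 2) k m0 (sqr_ge0 _) (sqr_ge0 _)
  pq1 pq2 k0 H'.
have L2 : L ^+ 2 <= (137 * m) ^+ 2.
  have L0 : 0 <= L by rewrite LE; clear - q1; lra.
  have Lm : L <= 137 * m by rewrite LE; clear - mq m6; lra.
  exact: le_sqr.
have m3 : 10 ^+ 8 * m ^+ 2 <= m ^+ 3 by rewrite [leRHS]exprS ler_wpM2r ?sqr_ge0.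
clear H H' LE qm mq pq1 pq2 q1 p0 p1 k0 m8.
have m1 : 4 * m + 1 <= 5 * m ^+ 2 by clear - m6; nra.
have -> : (1 + 2 / m) * (m ^+ 4 + 29 / 20 / 100 * a1 ^+ 4 + 7 / 125 * a2 ^+ 4) =
   m ^+ 4 + 2 * m ^+ 3 + 29 / 20 / 100 * a1 ^+ 4 + 7 / 125 * a2 ^+ 4
   + 29 / 20 / 100 * (2 * (a1 ^+ 2) ^+ 2 / m) + 7 / 125 * (2 * (a2 ^+ 2) ^+ 2 / m).
  by clear - m0; field; rewrite gt_eqF.
have m4 : (m + 1) ^+ 4 <= m ^+ 4 + 4 * m ^+ 3 + 11 * m ^+ 2 by clear - m1; lra.
lra.
Qed.

Lemma round_drift (R : realType) (p : R) h n z :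
  0 <= p -> p <= 3 / 250 -> onset <= (unit_size n)%:R :> R ->
  (choices n)%:R^-1 * \sum_(i < choices n) surv p h (round n i) (energy h n.+1) z
  <= (1 + 2 / n%:R) * energy h n z - n%:R ^+ 3 / 100.
Proof.
move=> p0 p1 hq; have p01 : 0 <= p <= 1 by apply/andP; split; lra.
have onset_ge : 10 ^+ 8 <= onset :> R by rewrite /onset; lra.
pose q : R := (unit_size n)%:R; rewrite -/q in hq.
have JE : (choices n)%:R = 18 * q + 2 :> R.
  by rewrite /choices natrM -(natr1 (9 * unit_size n)) natrM -/q; ring.
have J0 : 0 < (choices n)%:R :> R by rewrite JE; lra.
pose hit : R := \sum_(i < choices n) (1 - surv p h (round n i) (fun=> 1) z).
have hit0 : 0 <= hit by rewrite sumr_ge0 // => i _; rewrite subr_ge0 surv_le1.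
(* A killed walk gives up energy at least [(n + 1)^4]; [k] is the resulting average gain. *)
pose k := n.+1%:R ^+ 4 * hit / (choices n)%:R.
have k0 : 0 <= k by rewrite divr_ge0 ?mulr_ge0 ?exprn_ge0 // ltW.
apply: (@le_trans _ _ (energy_bound p h n z - k)).
  rewrite mulrC ler_pdivrMr // mulrBl /k divfK ?gt_eqF // /hit mulr_sumr.
  rewrite mulr_natr -[X in _ *+ X]card_ord -sumr_const -sumrB.
  apply: ler_sum => i _.
  apply: le_trans (surv_le_expect _ p _ h _ _ z p01 (energy_ge R h n.+1)) _.
  by rewrite lerD2r; exact: expect_energy.
apply: energy_bound_le => //; rewrite -/q.
have [nq qn] := unit_size_bounds R n; rewrite -/q in nq qn.
have q1000 : 1000 <= q by clear - hq onset_ge; lra.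
have [H1|H1] := leP `|(z.1 - h.1)%:~R : R| (182 * q); last first.
  right; left; rewrite -[leRHS]real_normK ?num_real //.
  by apply: le_sqr (ltW _); [clear - q1000; lra|].
have [H2|H2] := leP `|(z.2 - h.2)%:~R : R| (632 / 5 * q); last first.
  right; right; rewrite -[leRHS]real_normK ?num_real //.
  by apply: le_sqr (ltW _); [clear - q1000; lra|].
left; have q100 : 100 <= q by clear - q1000; lra.
have := round_hit_prob R p h n z p0 p1 q100 H1 H2; rewrite -/hit -/q => Hh.
have q0 : 0 < q by clear - q100; lra.
have Cq : 16 * 10 ^+ 3 * (65 * 100) ^+ 3 / q <= 1 / 100.
  by rewrite ler_pdivrMr //; clear - hq; move: hq; rewrite /onset; lra.
(* Here [978/1000] lies just below [247/250 * 99/100]. Since [50 q <= n], dividing [978/1000 n^4] by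
   [18 q + 2] still leaves [27/10 n^3]. *)
have {}Hh : 978 / 1000 <= hit.
  apply: le_trans Hh; apply: (@le_trans _ _ ((1 - p) * (99 / 100))); first by clear - p1; lra.
  by apply: ler_wpM2l; [clear - p1 | clear - Cq]; lra.
rewrite /k ler_pdivlMr // JE.
have m4 : n%:R ^+ 4 * (978 / 1000) <= n.+1%:R ^+ 4 * hit.
  apply: ler_pM Hh; [exact: exprn_ge0 | clear; lra |].
  by rewrite lerXn2r ?nnegrE // ler_nat.
apply: le_trans m4; rewrite [n%:R ^+ 4]exprSr.
have -> : 27 / 10 * n%:R ^+ 3 * (18 * q + 2) = n%:R ^+ 3 * (27 / 10 * (18 * q + 2)) by ring.
rewrite -[leRHS]mulrA; apply: ler_wpM2l; first exact: exprn_ge0.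
clear - q1000 nq; lra.
Qed.

(** * Concatenating the rounds *)

Definition codes (n : nat) : nat := (\prod_(i < n) choices i)%N.

(** The latest round is the last mixed-radix digit of [k], so forgetting it is an integer division
    and yields a prefix of the trail. *)
Fixpoint trail (n k : nat) : seq 'I_4 :=
  if n is m.+1 then trail m (k %/ choices m)%N ++ round m (k %% choices m)%N
  else [::].

Definition trail_length (n : nat) : nat := (\sum_(i < n) round_length i)%N.

Lemma choices_gt0 n : (0 < choices n)%N.
Proof. by rewrite /choices muln_gt0. Qed.

Lemma codes_gt0 n : (0 < codes n)%N.
Proof. by rewrite prodn_gt0 // => i; exact: choices_gt0. Qed.

Lemma codesS n : codes n.+1 = (codes n * choices n)%N.
Proof. by rewrite /codes big_ord_recr. Qed.

Lemma size_trail n k : size (trail n k) = trail_length n.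
Proof.
elim: n k => [|n IH] k /=; first by rewrite /trail_length big_ord0.
rewrite size_cat IH size_round ?ltn_mod ?choices_gt0 //.
by rewrite /trail_length big_ord_recr.
Qed.

Lemma trail_length_ge n : (n <= trail_length n)%N.
Proof.
elim: n => // n IH; rewrite /trail_length big_ord_recr /= -/(trail_length n).
by rewrite /round_length; lia.
Qed.

Lemma trail_lengthS n : trail_length n.+1 = (trail_length n + round_length n)%N.
Proof. by rewrite /trail_length big_ord_recr. Qed.

Lemma sum_divmod (V : nmodType) a b (F : nat -> nat -> V) : (0 < b)%N ->
  \sum_(k < a * b) F (k %/ b)%N (k %% b)%N = \sum_(i < a) \sum_(j < b) F i j.
Proof.
move=> b0; elim: a => [|a IH]; first by rewrite mul0n !big_ord0.
rewrite big_ord_recr /= -IH mulSnr big_split_ord /=; congr (_ + _).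
apply: eq_bigr => j _; rewrite divnMDl // modnMDl divn_small // modn_small //.
by rewrite addn0.
Qed.

(** The expectation over both the errors and the random choices of the first [n] rounds, all codes
    being equally likely. *)
Definition mean_surv {R : realType} (p : R) h n (f : pt -> R) : R :=
  (codes n)%:R^-1 * \sum_(k < codes n) surv p h (trail n k) f 0.

Lemma le_mean_surv (R : realType) (p : R) h n (f g : pt -> R) :
  0 <= p <= 1 -> (forall z, f z <= g z) -> mean_surv p h n f <= mean_surv p h n g.
Proof.
move=> p01 fg; rewrite /mean_surv ler_wpM2l ?invr_ge0 //.
by apply: ler_sum => k _; exact: le_surv.
Qed.

Lemma mean_surv_linear (R : realType) (p a b : R) h n (f g : pt -> R) :
  mean_surv p h n (fun z => a * f z + b * g z) =
  a * mean_surv p h n f + b * mean_surv p h n g.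
Proof.
rewrite /mean_surv; under eq_bigr do rewrite surv_linear.
by rewrite big_split /= -!mulr_sumr; ring.
Qed.

Lemma mean_survS (R : realType) (p : R) h n (f : pt -> R) :
  mean_surv p h n.+1 f = mean_surv p h n
    (fun z => (choices n)%:R^-1 * \sum_(i < choices n) surv p h (round n i) f z).
Proof.
rewrite /mean_surv codesS natrM invfM -mulrA; congr (_ * _).
rewrite (sum_divmod _ _ _ (fun k i => surv p h (trail n k ++ round n i) f 0)) ?choices_gt0 //.
rewrite mulr_sumr; apply: eq_bigr => k _.
rewrite (eq_surv _ _ _ _ _ (fun z => (choices n)%:R^-1 *
  (\sum_(i < choices n) surv p h (round n i) f z) + 0 * 0)); last by move=> z; rewrite mul0r addr0.
rewrite (surv_linear _ _ _ _ _ _ _ (fun=> 0)) mul0r addr0 surv_sum.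
by congr (_ * _); apply: eq_bigr => i _; rewrite surv_cat.
Qed.

Lemma mean_energyS (R : realType) (p : R) h n :
  0 <= p -> p <= 3 / 250 -> onset <= (unit_size n)%:R :> R ->
  mean_surv p h n.+1 (energy h n.+1) <=
  (1 + 2 / n%:R) * mean_surv p h n (energy h n) - n%:R ^+ 3 / 100 * mean_surv p h n (fun=> 1).
Proof.
move=> p0 p1 hn; have p01 : 0 <= p <= 1 by rewrite p0; clear - p1; lra.
rewrite mean_survS -mulNr -mean_surv_linear; apply: le_mean_surv => // z.
by rewrite mulr1; exact: round_drift.
Qed.

Lemma mean_surv_ge0 (R : realType) (p : R) h n f :
  0 <= p <= 1 -> (forall z, 0 <= f z) -> 0 <= mean_surv p h n f.
Proof.
move=> p01 f0; rewrite mulr_ge0 ?invr_ge0 // sumr_ge0 // => k _; exact: surv_ge0.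
Qed.

(* [1 + 2/n] is the ratio of consecutive values of [n (n + 1)]. *)
Lemma sum_mean_surv (R : realType) (p : R) h m : 0 <= p -> p <= 3 / 250 ->
  (0 < m)%N -> onset <= (unit_size m)%:R :> R ->
  exists C : R, forall n, \sum_(m <= i < n) i%:R * mean_surv p h i (fun=> 1) <= C.
Proof.
move=> p0 p1 m0 hm; have p01 : 0 <= p <= 1 by rewrite p0; clear - p1; lra.
pose b n := mean_surv p h n (energy h n) / (n%:R * n.+1%:R).
have b0 n : 0 <= b n.
  apply: divr_ge0; last by rewrite mulr_ge0.
  apply: mean_surv_ge0 => // z.
  by apply: le_trans (energy_ge R h n z); rewrite exprn_ge0.
have [c [c0 bS]] : exists c : R, 0 <= c /\ forall n, (m <= n)%N ->
    n%:R * mean_surv p h n (fun=> 1) <= c * (b n - b n.+1).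
  (* After the factor [1/100] a 6 remains, and [6 x^2 - (x + 1) (x + 2) = (x - 1) (5 x + 2)] is
     nonnegative for [x >= 1]. *)
  exists 600; split=> [|n mn]; first exact: ler0n.
  have hn : onset <= (unit_size n)%:R :> R.
    by apply: le_trans hm _; rewrite ler_nat /unit_size leq_div2r.
  have n1 : 1 <= n%:R :> R by rewrite ler1n (leq_trans m0).
  have := mean_energyS R p h n p0 p1 hn.
  have := mean_surv_ge0 R p h n (fun=> 1) p01 (fun=> ler01).
  rewrite /b -(natr1 n.+1) -(natr1 n).
  move: (mean_surv _ _ _ _) (mean_surv _ _ _ _) (mean_surv _ _ _ _) (n%:R : R) n1.
  move=> A A' S x x1 S0 H; clear - x1 S0 H.
  have x0 : 0 < x by lra.
  have d0 : 0 < (x + 1) * (x + 1 + 1) by rewrite mulr_gt0 //; lra.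
  have H' : A' / ((x + 1) * (x + 1 + 1)) <= A / (x * (x + 1)) - x ^+ 3 / 100 * S / ((x + 1) * (x + 1 + 1)).
    have -> : A / (x * (x + 1)) - x ^+ 3 / 100 * S / ((x + 1) * (x + 1 + 1)) =
      ((1 + 2 / x) * A - x ^+ 3 / 100 * S) / ((x + 1) * (x + 1 + 1)).
      by field; rewrite !gt_eqF //; lra.
    by rewrite ler_pM2r ?invr_gt0.
  have : x * S <= 600 * (x ^+ 3 / 100 * S / ((x + 1) * (x + 1 + 1))).
    have -> : 600 * (x ^+ 3 / 100 * S / ((x + 1) * (x + 1 + 1))) =
      (6 * x ^+ 3 * S) / ((x + 1) * (x + 1 + 1)) by field; rewrite !gt_eqF //; lra.
    rewrite ler_pdivlMr //.
    have -> : x * S * ((x + 1) * (x + 1 + 1)) = (x * ((x + 1) * (x + 1 + 1))) * S by ring.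
    apply: ler_wpM2r => //.
    have : 0 <= x * ((x - 1) * (5 * x + 2)).
      by apply: mulr_ge0; [|apply: mulr_ge0]; clear - x1; lra.
    clear; lra.
  move: H'; move: (_ / (_ * _)) (_ / (_ * _)) (_ / (_ * _)) => u v w; lra.
exists (c * b m) => n.
(* With [maxn] the telescoping bound also covers [n < m], where the sum is empty. *)
suff H : \sum_(m <= i < n) i%:R * mean_surv p h i (fun=> 1) <= c * (b m - b (maxn m n)).
  by apply: le_trans H _; rewrite ler_wpM2l // gerBl.
elim: n => [|n IH]; first by rewrite big_geq // maxn0 subrr mulr0.
have [mn|nm] := leqP m n.
  rewrite big_nat_recr //= (maxn_idPr _) 1?leqW //.
  by move: IH (bS n mn); rewrite (maxn_idPr mn); clear; lra.
by rewrite big_geq // (maxn_idPl nm) subrr mulr0.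
Qed.

(** * The auxiliary randomness *)

(* The first [n] mixed-radix digits of [w], packed into one number; the value
   outside [0, 1[ is chosen to make [code_div] hold everywhere. *)
Definition code {R : realType} (n : nat) (w : R) : nat :=
  if 0 <= w < 1 then Num.truncn (w * (codes n)%:R) else (codes n).-1.

Lemma code_lt (R : realType) n (w : R) : (code n w < codes n)%N.
Proof.
rewrite /code; case: ifPn => [/andP[w0 w1]|_]; last by rewrite ltn_predL codes_gt0.
rewrite truncn_lt_nat ?mulr_ge0 // -[ltRHS]mul1r ltr_pM2r // ltr0n.
exact: codes_gt0.
Qed.

(** Consistency of the digits: on [[0, 1[] it is the floor of a quotient, and elsewhere dividing the
    largest code gives the largest code. It makes the trails prefixes of one another. *)
Lemma code_div (R : realType) n (w : R) : code n w = (code n.+1 w %/ choices n)%N.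
Proof.
have J0 := choices_gt0 n; have D0 := codes_gt0 n.
rewrite /code codesS; case: ifPn => [/andP[w0 w1]|_]; last first.
  move: (codes n) (choices n) D0 J0 => [|a] [|b] // _ _.
  by rewrite mulSn /= addnC divnMDl // divn_small ?addn0.
apply: truncn_def; set N := Num.truncn _.
have /andP[N1 N2] : N%:R <= w * (codes n * choices n)%:R < N.+1%:R.
  by apply: truncn_itv; rewrite mulr_ge0.
have JR : 0 < (choices n)%:R :> R by rewrite ltr0n.
rewrite -(ler_pM2r JR) -(ltr_pM2r JR) -!natrM -mulrA -natrM.
apply/andP; split; first by apply: le_trans N1; rewrite ler_nat leq_divM.
by apply: lt_le_trans N2 _; rewrite ler_nat ltn_ceil.
Qed.

Lemma trail_prefix (R : realType) m n (w : R) : (m <= n)%N ->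
  exists l, trail n (code n w) = trail m (code m w) ++ l.
Proof.
elim: n => [|n IH] mn; first by exists [::]; move: mn; rewrite leqn0 => /eqP ->.
move: mn; rewrite leq_eqVlt => /predU1P[->|]; first by exists [::]; rewrite cats0.
rewrite ltnS => /IH[l El]; rewrite /= -code_div El -catA; by eexists.
Qed.

(** Every round is nonempty, so [t + 1] rounds contain index [t] and the default [ord0] is never
    reached. *)
Definition step {R : realType} (w : R) (t : nat) : 'I_4 :=
  nth ord0 (trail t.+1 (code t.+1 w)) t.

Lemma step_trail (R : realType) n (w : R) t : (t < trail_length n)%N ->
  nth ord0 (trail n (code n w)) t = step w t.
Proof.
move=> tn; rewrite /step.
have [l1 E1] := trail_prefix R n (maxn n t.+1) w (leq_maxl _ _).
have [l2 E2] := trail_prefix R t.+1 (maxn n t.+1) w (leq_maxr _ _).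
have := congr1 (nth ord0 ^~ t) E1; rewrite E2 !nth_cat !size_trail tn.
by rewrite (leq_trans (ltnSn t) (trail_length_ge t.+1)) => ->.
Qed.

Lemma mkseq_step (R : realType) n (w : R) :
  mkseq (step w) (trail_length n) = trail n (code n w).
Proof.
apply: (@eq_from_nth _ ord0) => [|t]; rewrite size_mkseq ?size_trail // => tn.
by rewrite nth_mkseq // step_trail.
Qed.

Lemma mkseq_step_take (R : realType) t n (w : R) : (t <= trail_length n)%N ->
  mkseq (step w) t = take t (trail n (code n w)).
Proof.
by move=> tn; rewrite -mkseq_step /mkseq -map_take take_iota (minn_idPl tn).
Qed.

Definition instructions {R : realType} (w : R) (t : nat) : pt := drift (mkseq (step w) t).

Lemma instructionsS (R : realType) (w : R) t :
  instructions w t.+1 = instructions w t + dir (step w t).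
Proof.
by rewrite /instructions mkseqS -cats1 drift_cat drift_cons /drift big_nil addr0.
Qed.

Lemma is_instr_instructions (R : realType) (w : R) : is_instr (instructions w).
Proof.
split; first by rewrite /instructions /drift /mkseq /= big_nil.
by move=> t; exists (step w t); exact: instructionsS.
Qed.

Lemma tail_prob_instructions (R : realType) (p : R) h t (w : R) :
  tail_prob p (instructions w) h t = surv p h (take t (trail t (code t w))) (fun=> 1) 0.
Proof.
rewrite (tail_prob_surv _ _ _ (step w)); last exact: instructionsS.
by rewrite -mkseq_step_take // trail_length_ge.
Qed.

Lemma tail_prob_le_trail (R : realType) (p : R) h n t (w : R) :
  0 <= p <= 1 -> (trail_length n <= t)%N ->
  tail_prob p (instructions w) h t <= surv p h (trail n (code n w)) (fun=> 1) 0.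
Proof.
move=> p01 nt; rewrite (tail_prob_surv _ _ _ (step w)); last exact: instructionsS.
rewrite -mkseq_step -(subnKC nt) /mkseq iotaD map_cat; exact: surv_catl.
Qed.

(** A level set is a half-open cell within [[0, 1[], joined for the last code by the complement of
    [[0, 1[]. *)
Lemma measurable_code (R : realType) n (S : set nat) :
  measurable [set w : R | S (code n w)].
Proof.
have -> : [set w : R | S (code n w)] = \bigcup_(k in S) [set w : R | code n w = k].
  apply/seteqP; split=> [w Sw|w [k Sk /= wk]]; first by exists (code n w).
  by rewrite /= wk.
apply: bigcup_measurable => k _.
have -> : [set w : R | code n w = k] =
    (`[0, 1[ `&` `[k%:R / (codes n)%:R, k.+1%:R / (codes n)%:R[) `|`
    (if k == (codes n).-1 then ~` `[0, 1[ else set0).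
  have D0 : 0 < (codes n)%:R :> R by rewrite ltr0n codes_gt0.
  apply/seteqP; split => w /=; rewrite /code !in_itv /=.
    case: ifPn => w01; last first.
      by move=> <-; right; rewrite eqxx /= in_itv /=; exact/negP.
    move=> <-; left; split => //; rewrite ler_pdivrMr // ltr_pdivlMr //.
    by apply: truncn_itv; rewrite mulr_ge0 //; case/andP: w01.
  case=> [[w01]|].
    by rewrite w01 ler_pdivrMr // ltr_pdivlMr //; exact: truncn_def.
  by case: ifPn => // /eqP -> /=; rewrite in_itv /= => /negP/negPf ->.
apply: measurableU; first by apply: measurableI; exact: measurable_itv.
by case: ifP => _; [apply: measurableC; exact: measurable_itv | exact: measurable0].
Qed.

Lemma measurable_fun_code (R : realType) d (T : measurableType d) n (g : nat -> T) :
  measurable_fun [set: R] (fun w : R => g (code n w)).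
Proof.
move=> _ Y mY; rewrite setTI.
exact: (measurable_code R n (fun k => Y (g k))).
Qed.

Lemma uniform_code (R : realType) n k :
  (uniform_prob (@ltr01 R) [set w : R | code n w = k] <= ((codes n)%:R^-1)%:E)%E.
Proof.
have D0 : 0 < (codes n)%:R :> R by rewrite ltr0n codes_gt0.
have mA := measurable_code R n [set k].
rewrite /uniform_prob integral_uniform_pdf.
set A := _ `&` _.
rewrite (eq_integral (fun=> 1%E)); last first.
  move=> w; rewrite inE => -[_] /=; rewrite in_itv /= /uniform_pdf => ->.
  by rewrite subr0 invr1.
rewrite integral_cst ?mul1e; last by apply: measurableI; [exact: mA | exact: measurable_itv].
apply: (@le_trans _ _ (lebesgue_measure `[k%:R / (codes n)%:R, k.+1%:R / (codes n)%:R])).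
  apply: le_measure; rewrite ?inE.
  - by apply: measurableI; [exact: mA | exact: measurable_itv].
  - exact: measurable_itv.
  - move=> w [] /=; rewrite !in_itv /= /code; case: ifPn => [/andP[w0 _] <- _|w01 <-].
      rewrite ler_pdivrMr // ler_pdivlMr //.
      have /andP[-> /ltW ->] // : (Num.truncn (w * (codes n)%:R))%:R <= w * (codes n)%:R
         < (Num.truncn (w * (codes n)%:R)).+1%:R.
      by apply: truncn_itv; rewrite mulr_ge0 // ltW.
    (* The endpoint 1 gets the last code by convention, and it closes the last cell. *)
    move=> /andP[w0 w1]; have -> : w = 1.
      by apply/eqP; rewrite eq_le w1 leNgt; move: w01; rewrite w0 /=.
    rewrite prednK ?codes_gt0 // divff ?gt_eqF // lexx andbT ler_pdivrMr // mul1r ler_nat.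
    exact: leq_pred.
rewrite lebesgue_measure_itv /= lte_fin ltr_pM2r ?invr_gt0 // ltr_nat ltnSn.
by rewrite -EFinD -mulrBl -natr1 addrAC subrr add0r mul1r.
Qed.

Lemma integral_code_le (R : realType) n (G : nat -> R) : (forall k, 0 <= G k) ->
  (\int[uniform_prob (@ltr01 R)]_w (G (code n w))%:E <=
    ((codes n)%:R^-1 * \sum_(k < codes n) G k)%:E)%E.
Proof.
move=> G0; pose A k := [set w : R | code n w = k].
have mA k : measurable (A k) by exact: (measurable_code R n [set k]).
have -> : (fun w : R => (G (code n w))%:E) =
    (fun w => \sum_(k < codes n) ((G k)%:E * (\1_(A k) w)%:E))%E.
  apply/funext => w; rewrite (bigD1 (Ordinal (code_lt R n w))) //= indicE mem_set // mule1.
  rewrite big1 ?adde0 // => k kw; rewrite indicE memNset ?mule0 // => E.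
  by move/eqP: kw; apply; apply: val_inj.
rewrite ge0_integral_sum //=; last 2 first.
- by move=> k; apply: measurable_funeM; apply/measurable_EFinP; apply: measurable_indic; exact: mA.
- by move=> k w _; rewrite mule_ge0 // lee_fin.
rewrite mulr_sumr -sumEFin; apply: lee_sum => k _.
rewrite ge0_integralZl //=; last by rewrite lee_fin.
- rewrite integral_indic; [|exact: measurableT|exact: mA].
  rewrite (_ : A k `&` _ = A k); last exact: setIT.
  by rewrite mulrC EFinM lee_wpmul2l ?lee_fin // uniform_code.
- by apply/measurable_EFinP; apply: measurable_indic; exact: mA.
Qed.

(** * The critical error rate *)

Lemma expR_double (R : realType) (b b' x : R) :
  b <= expR x -> 0 <= b -> b' <= b ^+ 2 -> b' <= expR (x + x).
Proof.
move=> bx b0 bb; rewrite expRD -expr2; apply: le_trans bb _; exact: le_sqr.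
Qed.

(** Repeated squaring, where each square is rounded down to a simple rational listed in [s]. *)
Lemma expR_halvings (R : realType) (y : R) (s : seq R) x : 0 <= y -> y <= expR x ->
  all (fun b => 0 <= b) s -> path (fun b b' => b' <= b ^+ 2) y s ->
  last y s <= expR (x *+ (2 ^ size s)%N).
Proof.
elim: s y x => [|b s IH] y x y0 yx /=; first by rewrite expn0 mulr1n.
move=> /andP[b0 s0] /andP[by2 ps]; rewrite expnS mulrnA; apply: IH => //.
by rewrite mulr2n; exact: expR_double by2.
Qed.

(** Since [16/5 = 512/160], nine squarings start from [exp x >= 1 + x] at [x = - 1/160] and
    [x = 1/160]; the latter is then inverted. The tangent argument of [cstar_le] asks for exactly
    these bounds, [124/5 E >= 1] and [E <= 53/1250]. *)
Lemma expR_16_5 (R : realType) :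
  5 / 124 <= expR (- (16 / 5)) :> R /\ expR (- (16 / 5)) <= 53 / 1250 :> R.
Proof.
have M9 (y : R) : y *+ (2 ^ 9)%N = y * 2 ^+ 9 by rewrite -(mulr_natr y) natrX.
split.
  have -> : - (16 / 5) = (- (1 / 160)) *+ (2 ^ 9)%N :> R by rewrite M9; field.
  apply: (@expR_halvings R (159 / 160) [:: 317 / 321; 315 / 323; 486 / 511; 199 / 220; 9 / 11;
    81 / 121; 203 / 453; 99 / 493; 5 / 124]).
  - lra.
  - by have := expR_ge1Dx (- (1 / 160) : R); clear; lra.
  - rewrite /= ?andbT; repeat (apply/andP; split); clear; lra.
  - rewrite /= ?andbT; repeat (apply/andP; split); clear; lra.
have H : 262 / 11 <= expR (16 / 5) :> R.
  have -> : 16 / 5 = (1 / 160) *+ (2 ^ 9)%N :> R by rewrite M9; field.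
  apply: (@expR_halvings R (161 / 160) [:: 81 / 80; 204 / 199; 62 / 59; 53 / 48; 89 / 73;
    272 / 183; 433 / 196; 449 / 92; 262 / 11]).
  - lra.
  - by have := expR_ge1Dx (1 / 160 : R); clear; lra.
  - rewrite /= ?andbT; repeat (apply/andP; split); clear; lra.
  - rewrite /= ?andbT; repeat (apply/andP; split); clear; lra.
rewrite expRN -(ler_pM2r (expR_gt0 (16 / 5))) mulVf ?gt_eqF ?expR_gt0 //.
lra.
Qed.

(* The tangent to [exp (- u)] at [u = 26/5] is used, close to the maximiser [a^2 / 4 = 5.21...]. *)
Lemma cstar_le (R : realType) : cstar <= 53 / 2500 :> R.
Proof.
apply: ge_sup; first by eexists; exists 1 => //=.
move=> _ [a /= a0 <-]; have a2 : 0 < a ^+ 2 by rewrite exprn_gt0.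
rewrite ler_pdivrMr ?mulr_gt0 //.
have [E1 E2] := expR_16_5 R; set E := expR _ in E1 E2.
have -> : - a ^+ 2 / 4 + 2 = - (16 / 5) + (26 / 5 - a ^+ 2 / 4) by field.
rewrite expRD -/E.
have E0 : 0 <= E by rewrite expR_ge0.
have := ler_wpM2l E0 (expR_ge1Dx (26 / 5 - a ^+ 2 / 4)).
have := ler_wpM2r (ltW a2) E2.
move: (expR _) => X; lra.
Qed.

(** Squaring removes the root. As [p^2 (3 - 2 p)] increases and [(1 - p)^2] decreases on []0, 1[],
    it suffices to compare at [3/250], where the margin is thin: about 4.2854e-4 against
    4.2825e-4. *)
Lemma p0_le (R : realType) (p0 : R) : 0 < p0 < 1 -> p0_fun p0 = cstar -> p0 <= 3 / 250.
Proof.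
move=> /andP[p_gt0 p_lt1] E; rewrite leNgt; apply/negP => p_gt.
have := cstar_le R; rewrite -E /p0_fun ler_pdivrMr ?exprn_gt0 ?subr_gt0 //.
set s := Num.sqrt _ => H.
have s2 : s ^+ 2 = 3 - 2 * p0 by rewrite sqr_sqrtr //; clear - p_lt1; lra.
have s0 : 0 <= s by rewrite sqrtr_ge0.
have ps : p0 * s <= 53 / 2500 * (247 / 250) ^+ 2.
  apply: le_trans H _; apply: ler_wpM2l; first by clear; lra.
  by apply: le_sqr; clear - p_lt1 p_gt; lra.
have := le_sqr _ _ _ (mulr_ge0 (ltW p_gt0) s0) ps.
rewrite exprMn s2 => {}H.
have : (3 / 250) ^+ 2 * (3 - 2 * (3 / 250)) <= p0 ^+ 2 * (3 - 2 * p0).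
  have : 0 <= (p0 - 3 / 250) * (3 * (p0 + 3 / 250) - 2 * (p0 ^+ 2 + p0 * (3 / 250) + (3 / 250) ^+ 2)).
    apply: mulr_ge0; first by clear - p_gt; lra.
    by clear - p_gt0 p_lt1; nra.
  by clear; lra.
by move: H; clear; lra.
Qed.

(** * Summation over time and conclusion *)

Lemma sum_integral_le (R : realType) (a : nat -> \bar R) (s : nat -> R) n :
  (forall k t, (trail_length k <= t)%N -> (a t <= (s k)%:E)%E) ->
  (\sum_(0 <= t < trail_length n) a t <= (\sum_(0 <= i < n) (round_length i)%:R * s i)%:E)%E.
Proof.
move=> as_le; elim: n => [|n IH].
  by rewrite /trail_length big_ord0 !big_geq.
rewrite trail_lengthS (@big_cat_nat _ _ _ (trail_length n)) ?leq_addr //=.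
rewrite big_nat_recr //= EFinD; apply: leeD => //.
(* Each time within round [n] is charged the bound [s n] valid from the start of that round. *)
apply: (@le_trans _ _ (\sum_(trail_length n <= t < trail_length n + round_length n) (s n)%:E)%E).
  by rewrite !big_nat; apply: lee_sum => t /andP[nt _]; exact: as_le.
by rewrite sumEFin lee_fin sumr_const_nat addKn mulr_natl.
Qed.

Theorem theorem2 (R : realType) (p0 : R) :
  0 < p0 < 1 -> p0_fun p0 = cstar ->
  exists (d : measure_display) (Omega : measurableType d)
         (P : probability Omega R) (ins : pt -> Omega -> nat -> pt),
    (forall h w, is_instr (ins h w)) /\
    (forall h t z, measurable [set w | ins h w t = z]) /\
    (forall p : R, 0 <= p -> p < p0 -> forall h : pt,
       (\int[P]_(w in setT) expected_hit p (ins h w) h < +oo)%E).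
Proof.
move=> p0_01 p0E; have p0_max := p0_le R p0 p0_01 p0E.
exists _, _, (uniform_prob (@ltr01 R)), (fun=> instructions).
split=> [h w|]; first exact: is_instr_instructions.
split=> [h t z|p p_ge0 p_lt h].
  have -> : [set w : R | instructions w t = z] =
      [set w | drift (take t (trail t (code t w))) = z].
    by apply/seteqP; split=> w /=; rewrite /instructions (mkseq_step_take _ _ t) ?trail_length_ge.
  exact: (measurable_code R t (fun k => drift (take t (trail t k)) = z)).
have p_max : p <= 3 / 250 by exact: le_trans (ltW p_lt) p0_max.
have p01 : 0 <= p <= 1 by rewrite p_ge0; clear - p_max; lra.
pose tail (t : nat) (w : R) := (tail_prob p (instructions w) h t)%:E.
have tail_code t : (fun w : R => tail t w) =
    (fun w => (surv p h (take t (trail t (code t w))) (fun=> 1) 0)%:E).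
  by apply/funext => w; rewrite /tail tail_prob_instructions.
have tail0 t w : (0 <= tail t w)%E.
  by rewrite lee_fin tail_prob_instructions surv_ge0.
have m_tail t : measurable_fun [set: R] (fun w : R => tail t w).
  rewrite tail_code.
  exact: (measurable_fun_code R _ _ t (fun k => (surv p h (take t (trail t k)) (fun=> 1) 0)%:E)).
rewrite /expected_hit integral_nneseries //; last by move=> n w _; exact: tail0.
pose a t := (\int[uniform_prob (@ltr01 R)]_w tail t w)%E.
have a_le n t : (trail_length n <= t)%N -> (a t <= (mean_surv p h n (fun=> 1))%:E)%E.
  move=> nt; apply: le_trans (integral_code_le R n
    (fun k => surv p h (trail n k) (fun=> 1) 0) _); last by move=> k; exact: surv_ge0.
  apply: ge0_le_integral => //=.
  - exact: m_tail.
  - exact: (measurable_fun_code R _ _ n (fun k => (surv p h (trail n k) (fun=> 1) 0)%:E)).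
  - by move=> w _; rewrite lee_fin; exact: tail_prob_le_trail.
pose m := (50 * (Num.truncn (onset : R)).+1)%N.
have m0 : (0 < m)%N by [].
have hm : onset <= (unit_size m)%:R :> R.
  by rewrite /unit_size /m mulKn //; apply/ltW; exact: truncnS_gt.
have [C HC] := sum_mean_surv R p h m p_ge0 p_max m0 hm.
(* The rounds before the onset contribute at most their lengths. *)
pose C0 : R := \sum_(0 <= i < m) (round_length i)%:R.
have S0 i : 0 <= mean_surv p h i (fun=> 1) by apply: mean_surv_ge0.
have bound n : \sum_(0 <= i < n) (round_length i)%:R * mean_surv p h i (fun=> 1) <= C0 + 139 * C.
  (* The length is at most [6820/50 i + 2], which is below [139 i] for [i >= 1]. *)
  have len_le i : (0 < i)%N -> (round_length i)%:R <= 139 * i%:R :> R.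
    by move=> i0; rewrite -natrM ler_nat /round_length /unit_size; lia.
  have S1 i : mean_surv p h i (fun=> 1) <= 1.
    rewrite /mean_surv ler_pdivrMl ?ltr0n ?codes_gt0 // mulr1.
    apply: (@le_trans _ _ (\sum_(k < codes i) 1)); last by rewrite sumr_const card_ord.
    by apply: ler_sum => k _; exact: surv_le1.
  apply: (@le_trans _ _ (\sum_(0 <= i < maxn m n) (round_length i)%:R * mean_surv p h i (fun=> 1))).
    rewrite (@big_cat_nat _ _ _ n _ (maxn m n)) ?leq_maxr //= lerDl.
    by apply: sumr_ge0 => i _; rewrite mulr_ge0.
  rewrite (@big_cat_nat _ _ _ m _ (maxn m n)) ?leq_maxl //=; apply: lerD.
    by apply: ler_sum => i _; rewrite ler_piMr.
  apply: (@le_trans _ _ (139 * \sum_(m <= i < maxn m n) i%:R * mean_surv p h i (fun=> 1))).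
    rewrite mulr_sumr !big_nat; apply: ler_sum => i /andP[mi _]; rewrite mulrA.
    by apply: ler_wpM2r => //; apply: len_le; exact: leq_trans mi.
  by apply: ler_wpM2l => //; exact: HC.
apply: (@le_lt_trans _ _ (C0 + 139 * C)%:E); last exact: ltry.
apply: lime_le.
  by apply: is_cvg_nneseries => n _ _; apply: integral_ge0 => w _; exact: tail0.
near=> n.
(* As [n <= trail_length n], the partial sum can be extended to the end of [n] complete rounds. *)
apply: le_trans (_ : \sum_(0 <= t < trail_length n) a t <= _)%E.
  rewrite (@big_cat_nat _ _ _ n _ (trail_length n)) ?trail_length_ge //= leeDl // sume_ge0 // => t _.
  by apply: integral_ge0 => w _; exact: tail0.
by apply: le_trans (sum_integral_le _ _ _ n a_le) _; rewrite lee_fin.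
Unshelve. all: by end_near.
Qed.
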